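(* Let $k$ be a field and let $\Lambda$ be a finite dimensional basic $\mathfrak{r}$-split $k$-algebra. Then $\Lambda \simeq T(\mathcal{S}_\Lambda)/\langle \rho \rangle$ with $J^{\operatorname{rl}(\Lambda)} \subset \langle \rho \rangle \subset J^2$, where $\mathcal{S}_\Lambda$ is the species of $\Lambda$ and $\rho$ is a set of relations on $\mathcal{S}_\Lambda$.
   Context: Algebras. $\mathfrak{r} = \operatorname{rad}\Lambda$ is the Jacobson radical. $\Lambda$ is basic if ${}_\Lambda\Lambda$ is a direct sum of pairwise non-isomorphic indecomposable projective left modules; then $\Lambda/\mathfrak{r} \simeq \bigoplus_{i\in I} D_i$ with $D_i$ division rings. $\operatorname{rl}(\Lambda)$ is the smallest $n$ with $\mathfrak{r}^n = (0)$. Let $\pi\colon \Lambda \to \Lambda/\mathfrak{r}$ be the natural projection. $\Lambda$ is split if there is a $k$-algebra homomorphism $\epsilon\colon \Lambda/\mathfrak{r} \to \Lambda$ with $\pi\epsilon = \operatorname{id}_{\Lambda/\mathfrak{r}}$. A split algebra $\Lambda$ is $\mathfrak{r}$-split if for any such $\epsilon$ the short exact sequence $0 \to \mathfrak{r}^2 \to \mathfrak{r} \to \mathfrak{r}/\mathfrak{r}^2 \to 0$ splits as a sequence of $\Lambda/\mathfrak{r}$-$\Lambda/\mathfrak{r}$-bimodules, the bimodule structures being given via $\epsilon$. Species. A $k$-species $\mathcal{S} = (D_i, {}_jM_i)_{i,j\in I}$ consists of division rings $D_i$, finite dimensional over a common central subfield $k$, and $D_j$-$D_i$-bimodules ${}_jM_i$,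 finite dimensional over $k$ with $\lambda m = m\lambda$ for $\lambda \in k$, $m\in {}_jM_i$. (Then automatically $\operatorname{Hom}_{D_i}({}_jM_i,D_i)\simeq \operatorname{Hom}_{D_j}({}_jM_i,D_j)$ as $D_i$-$D_j$-bimodules.) Its underlying quiver $Q_\mathcal{S}$ has vertex set $I$ and one arrow $i\to j$ for each ${}_jM_i\neq (0)$. Put $D = \bigoplus_i D_i$, $M = \bigoplus_{i,j} {}_jM_i$ (a $D$-$D$-bimodule), $M^{(0)} = D$, and $M^{(n)}$ the $n$-fold tensor product of $M$ over $D$. The tensor algebra is $T(\mathcal{S}) = T(D,M) = \bigoplus_{n\ge 0} M^{(n)}$ with multiplication given by the tensor product, and $J = \bigoplus_{n\ge 1} M^{(n)}$. Relations. A relation on $\mathcal{S}$ starting in $a\in I$ and ending in $b\in I$ is a finite sum $\sigma = g_1+\cdots+g_n$ where each $g_l = g_{l,n_l}\otimes\cdots\otimes g_{l,1}$, $n_l\ge 1$, is an elementary tensor in ${}_{i_{n_l}}M_{i_{n_l-1}}\otimes_{D_{i_{n_l-1}}}\cdots\otimes_{D_{i_1}} {}_{i_1}M_{i_0}$ for some path $a=i_0\to i_1\to\cdots\to i_{n_l}=b$ (depending on $l$) in $Q_\mathcal{S}$. A set of relations is a set $\rho$ of relations (possibly with different start and end vertices); $\langle\rho\rangle$ is the two-sided ideal of $T(\mathcal{S})$ it generates. Species of $\Lambda$. $\mathfrak{r}/\mathfrak{r}^2$ is a $\Lambda/\mathfrak{r}$-$\Lambda/\mathfrak{r}$-bimodule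 in the natural way. The species of a finite dimensional basic $k$-algebra $\Lambda$ is the $k$-species $\mathcal{S}_\Lambda = (D_i, {}_jM_i)_{i,j\in I}$ with $\Lambda/\mathfrak{r}\simeq\bigoplus_{i\in I} D_i$ and ${}_jM_i = D_j(\mathfrak{r}/\mathfrak{r}^2)D_i$. *)

(* Defs.v *)
From HB Require Import structures.
From mathcomp Require Import all_boot all_order all_algebra all_field.
From mathcomp Require Import boolp classical_sets.
From mathcomp Require Import freeg.

Set Implicit Arguments.
Unset Strict Implicit.
Unset Printing Implicit Defensive.

Import GRing.Theory.
Local Open Scope ring_scope.
Local Open Scope classical_set_scope.

(******************************************************************************)
(* Conventions.  Rings are pzRingType, so that quotients and finite products  *)
(* are defined without nontriviality side conditions.  A k-algebra which is   *)
(* not a library falgType k is a ring A together with its structural map      *)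
(* k -> A; k-algebra homomorphisms are the ring homomorphisms compatible with *)
(* the structural maps (c |-> c%:A for a falgType k).                         *)
(******************************************************************************)

Section Ideals.
Variable R : pzRingType.
Implicit Types (I J X : set R).

Definition is_zsub I : Prop := I 0 /\ forall x y, I x -> I y -> I (x - y).

Definition is_lideal I : Prop := is_zsub I /\ forall a x, I x -> I (a * x).

Definition is_ideal I : Prop := is_lideal I /\ forall x a, I x -> I (x * a).

Definition is_max_lideal I : Prop :=
  [/\ is_lideal I, ~ I 1 &
      forall J, is_lideal J -> I `<=` J -> J = I \/ J = setT].

End Ideals.

Record ideal (R : pzRingType) := Ideal {
  ideal_mem :> R -> Prop;
  ideal_memP : is_ideal ideal_mem }.

Definition ideal_set (R : pzRingType) (I : ideal R) : set R := ideal_mem I.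
Coercion ideal_set : ideal >-> set.

Section ZSpan.
Variable V : zmodType.

Definition zspan (X : set V) : set V :=
  [set v | forall Y : set V, Y 0 -> (forall x y, Y x -> Y y -> Y (x - y)) ->
           X `<=` Y -> Y v].

Lemma zspan0 X : zspan X 0. Proof. by move=> Y Y0 _ _. Qed.

Lemma zspanB X x y : zspan X x -> zspan X y -> zspan X (x - y).
Proof. by move=> hx hy Y Y0 YB XY; exact: YB (hx Y Y0 YB XY) (hy Y Y0 YB XY). Qed.

Lemma zspanN X x : zspan X x -> zspan X (- x).
Proof. by move=> hx; rewrite -[- x]add0r; apply: zspanB => //; exact: zspan0. Qed.

Lemma zspanD X x y : zspan X x -> zspan X y -> zspan X (x + y).
Proof. by move=> hx hy; rewrite -[y]opprK; apply: zspanB => //; exact: zspanN. Qed.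

Lemma sub_zspan X : X `<=` zspan X.
Proof. by move=> x Xx Y _ _; apply. Qed.

Definition zspanb X : {pred V} := fun v => `[< zspan X v >].

Lemma zspanb_closed X : zmod_closed (zspanb X).
Proof.
split; first by rewrite unfold_in; apply/asboolP; exact: zspan0.
by move=> x y; rewrite !unfold_in => /asboolP hx /asboolP hy; apply/asboolP; exact: zspanB.
Qed.
HB.instance Definition _ X := GRing.isZmodClosed.Build V (zspanb X)
  (zspanb_closed X).

End ZSpan.

Section IdealTheory.
Variable R : pzRingType.
Implicit Types (I J : ideal R).

Lemma ideal0 I : I 0. Proof. by case: I => I [[[]]]. Qed.
Lemma idealB I x y : I x -> I y -> I (x - y).
Proof. by case: I => I [[[? +] ?] ?] /=; apply. Qed.
Lemma idealMl I a x : I x -> I (a * x).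
Proof. by case: I => I [[? +] ?] /=; apply. Qed.
Lemma idealMr I x a : I x -> I (x * a).
Proof. by case: I => I [? +] /=; apply. Qed.
Lemma idealN I x : I x -> I (- x).
Proof. by move=> ?; rewrite -sub0r; apply: idealB => //; exact: ideal0. Qed.
Lemma idealD I x y : I x -> I y -> I (x + y).
Proof. by move=> ? /idealN ?; rewrite -[y]opprK; exact: idealB. Qed.

Definition idealb I : {pred R} := fun x => `[< I x >].

Lemma idealb_closed I : zmod_closed (idealb I).
Proof.
split; first by rewrite unfold_in; apply/asboolP; exact: ideal0.
by move=> x y; rewrite !unfold_in => /asboolP hx /asboolP hy; apply/asboolP; exact: idealB.
Qed.
HB.instance Definition _ I := GRing.isZmodClosed.Build R (idealb I)
  (idealb_closed I).
Definition ideal_zmodc I := GRing.ZmodClosed.clone R (idealb I) _.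

Lemma ideal_genP (X : set R) :
  is_ideal (\bigcap_(I in [set I | is_ideal I /\ X `<=` I]) I).
Proof.
do ![split].
- by move=> I [[[[I0 _] _] _] _].
- by move=> x y hx hy I /[dup] hI [[[[_ IB] _] _] _]; apply: IB; [apply: hx|apply: hy].
- by move=> a x hx I /[dup] hI [[[_ IM] _] _]; apply: IM; apply: hx.
- by move=> x a hx I /[dup] hI [[_ IM] _]; apply: IM; apply: hx.
Qed.

Definition ideal_gen (X : set R) : ideal R := Ideal (ideal_genP X).

Lemma ideal_fullP : is_ideal (@setT R). Proof. by do ![split]. Qed.
Definition ideal_full : ideal R := Ideal ideal_fullP.

Lemma ideal_mulP I J :
  is_ideal (zspan [set z | exists x y, [/\ I x, J y & z = x * y]]).
Proof.
do ![split]; first exact: zspan0.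
- exact: zspanB.
- move=> a x hx; apply: (hx (fun x => zspan _ (a * x))).
  + by rewrite mulr0; exact: zspan0.
  + by move=> u v hu hv; rewrite mulrBr; exact: zspanB.
  + move=> _ [u [v [Iu Jv ->]]]; apply: sub_zspan; exists (a * u), v.
    by rewrite mulrA; split=> //; exact: idealMl.
- move=> x a hx; apply: (hx (fun x => zspan _ (x * a))).
  + by rewrite mul0r; exact: zspan0.
  + by move=> u v hu hv; rewrite mulrBl; exact: zspanB.
  + move=> _ [u [v [Iu Jv ->]]]; apply: sub_zspan; exists u, (v * a).
    by rewrite mulrA; split=> //; exact: idealMr.
Qed.

(* the additive subgroup generated by the products; I^0 = R below *)
Definition ideal_mul I J : ideal R := Ideal (ideal_mulP I J).
Definition ideal_exp I n : ideal R := iter n (ideal_mul I) ideal_full.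

Lemma jacobson_radP : is_ideal (\bigcap_(L in @is_max_lideal R) L).
Proof.
do ![split].
- by move=> L [[[L0 _] _] _ _].
- move=> x y hx hy L /[dup] hL [[[_ LB] _] _ _].
  by apply: LB; [apply: hx|apply: hy].
- by move=> a x hx L /[dup] hL [[_ LM] _ _]; apply: LM; apply: hx.
- move=> x a hx L /[dup] hL [[[L0 LB] LM] L1 Lmax].
  have LN u : L u -> L (- u) by move=> ?; rewrite -sub0r; apply: LB.
  have LD u v : L u -> L v -> L (u + v).
    by move=> ? /LN ?; rewrite -[v]opprK; apply: LB.
  have [La|nLa] := pselect (L a); first exact: LM.
  apply: (hx (fun y => L (y * a))); split.
  + do ![split].
    * by rewrite mul0r.
    * by move=> u v ? ?; rewrite mulrBl; apply: LB.
    * by move=> b u ?; rewrite -mulrA; apply: LM.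
  + by rewrite mul1r.
  + move=> K [[K0 KB] KM] LK.
    have KN u : K u -> K (- u) by move=> ?; rewrite -sub0r; apply: KB.
    have KD u v : K u -> K v -> K (u + v).
      by move=> ? /KN ?; rewrite -[v]opprK; apply: KB.
    have [KL|] := pselect (K `<=` (fun y => L (y * a))).
      by left; apply/seteqP; split.
    move=> /existsNP[y /not_implyP[Ky nLy]]; right.
    pose N := [set z | exists u b, L u /\ z = u + b * (y * a)].
    have NT : N = setT.
      have hN : is_lideal N.
        do ![split].
        - by exists 0, 0; rewrite mul0r addr0.
        - move=> _ _ [u [b [Lu ->]]] [v [c [Lv ->]]].
          exists (u - v), (b - c); split; first exact: LB.
          by rewrite mulrBl opprD addrACA.
        - move=> c _ [u [b [Lu ->]]]; exists (c * u), (c * b).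
          by rewrite mulrDr mulrA; split=> //; exact: LM.
      have LN' : L `<=` N by move=> u Lu; exists u, 0; rewrite mul0r addr0.
      case: (Lmax N hN LN') => // NL; case: nLy; rewrite -NL.
      by exists 0, 1; rewrite add0r mul1r.
    have [u [b [Lu aE]]] : N a by rewrite NT.
    have K1 : K 1.
      rewrite -(subrK (b * y) 1); apply: KD; last exact: KM.
      apply: LK; rewrite mulrBl mul1r -mulrA.
      by rewrite {1}aE addrK.
    by apply/seteqP; split=> // z _; rewrite -[z]mulr1; apply: KM.
Qed.

Definition jacobson_rad : ideal R := Ideal jacobson_radP.

(* the least n with rad(R)^n = 0 (and 0 when rad(R) is not nilpotent) *)
Definition rad_length : nat :=
  match pselect (exists n, `[< ideal_exp jacobson_rad n = [set 0] :> set R >])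
  with
  | left e => ex_minn e
  | right _ => 0
  end.

End IdealTheory.

Section RingQuotient.
Variables (R : pzRingType) (I : ideal R).
Local Open Scope quotient_scope.

Definition rquot : Type := Quotient.quot (ideal_zmodc I).
HB.instance Definition _ := GRing.Zmodule.on rquot.

Definition rquot_pi (x : R) : rquot := \pi_(Quotient.quot (ideal_zmodc I)) x.
Definition rquot_repr (x : rquot) : R := repr (x : Quotient.quot (ideal_zmodc I)).

Lemma rquot_reprK x : rquot_pi (rquot_repr x) = x.
Proof. exact: reprK. Qed.

Lemma rquot_piP x y : rquot_pi x = rquot_pi y <-> I (x - y).
Proof.
split=> [/eqP|h].
  by rewrite /rquot_pi -Quotient.idealrBE => /asboolP.
by apply/eqP; rewrite /rquot_pi -Quotient.idealrBE; exact/asboolP.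
Qed.

Lemma rquot_piB : zmod_morphism rquot_pi.
Proof. by move=> x y; rewrite /rquot_pi !piE. Qed.
HB.instance Definition _ := GRing.isZmodMorphism.Build R rquot rquot_pi rquot_piB.

Definition rquot_mul (x y : rquot) := rquot_pi (rquot_repr x * rquot_repr y).

Lemma rquot_piM x y : rquot_mul (rquot_pi x) (rquot_pi y) = rquot_pi (x * y).
Proof.
apply/rquot_piP; set x' := rquot_repr _; set y' := rquot_repr _.
have hx : I (x' - x) by apply/rquot_piP; rewrite rquot_reprK.
have hy : I (y' - y) by apply/rquot_piP; rewrite rquot_reprK.
have -> : x' * y' - x * y = (x' - x) * y' + x * (y' - y).
  by rewrite mulrBl mulrBr addrA subrK.
by apply: idealD; [exact: idealMr|exact: idealMl].
Qed.

Fact rquot_mulA : associative rquot_mul.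
Proof.
move=> x y z; rewrite -(rquot_reprK x) -(rquot_reprK y) -(rquot_reprK z).
by rewrite !rquot_piM mulrA.
Qed.
Fact rquot_mul1l : left_id (rquot_pi 1) rquot_mul.
Proof. by move=> x; rewrite -(rquot_reprK x) rquot_piM mul1r. Qed.
Fact rquot_mul1r : right_id (rquot_pi 1) rquot_mul.
Proof. by move=> x; rewrite -(rquot_reprK x) rquot_piM mulr1. Qed.
Fact rquot_mulDl : left_distributive rquot_mul +%R.
Proof.
move=> x y z; rewrite -(rquot_reprK x) -(rquot_reprK y) -(rquot_reprK z).
by rewrite -raddfD !rquot_piM mulrDl raddfD.
Qed.
Fact rquot_mulDr : right_distributive rquot_mul +%R.
Proof.
move=> x y z; rewrite -(rquot_reprK x) -(rquot_reprK y) -(rquot_reprK z).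
by rewrite -raddfD !rquot_piM mulrDr raddfD.
Qed.

HB.instance Definition _ := GRing.Zmodule_isPzRing.Build rquot
  rquot_mulA rquot_mul1l rquot_mul1r rquot_mulDl rquot_mulDr.

Fact rquot_pi_monoid : monoid_morphism rquot_pi.
Proof. by split=> // x y; rewrite -rquot_piM. Qed.
HB.instance Definition _ :=
  GRing.isMonoidMorphism.Build R rquot rquot_pi rquot_pi_monoid.

End RingQuotient.

Section Bimodules.

Record is_bimod (A B : pzRingType) (V : zmodType)
    (l : A -> V -> V) (r : V -> B -> V) : Prop := IsBimod {
  bim_l1 : forall v, l 1 v = v;
  bim_lM : forall a b v, l (a * b) v = l a (l b v);
  bim_lDl : forall a b v, l (a + b) v = l a v + l b v;
  bim_lDr : forall a v w, l a (v + w) = l a v + l a w;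
  bim_r1 : forall v, r v 1 = v;
  bim_rM : forall v a b, r v (a * b) = r (r v a) b;
  bim_rDr : forall v a b, r v (a + b) = r v a + r v b;
  bim_rDl : forall v w a, r (v + w) a = r v a + r w a;
  bim_lr : forall a v b, l a (r v b) = r (l a v) b }.

Record bimod (A B : pzRingType) := Bimod {
  bim_car :> zmodType;
  bim_l : A -> bim_car -> bim_car;
  bim_r : bim_car -> B -> bim_car;
  bimP : is_bimod bim_l bim_r }.

Lemma regular_bimodP (A : pzRingType) : is_bimod ( *%R : A -> A -> A) *%R.
Proof.
split=> *; by rewrite ?mul1r ?mulr1 ?mulrA ?mulrDl ?mulrDr.
Qed.

Definition regular_bimod (A : pzRingType) : bimod A A :=
  Bimod (regular_bimodP A).

End Bimodules.

(* I as an R-R-bimodule, and I / I^2, both as an R-R-bimodule and as an       *)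
(* R/I-R/I-bimodule                                                           *)
Section IdealBimodules.
Variables (R : pzRingType) (I : ideal R).

Record ideal_sub := IdealSub { ideal_val : R; _ : idealb I ideal_val }.
HB.instance Definition _ := [isSub for ideal_val].
HB.instance Definition _ := [Choice of ideal_sub by <:].
HB.instance Definition _ := [SubChoice_isSubZmodule of ideal_sub by <:].

Lemma ideal_valP (x : ideal_sub) : I (ideal_val x).
Proof. by case: x => x /= /asboolP. Qed.

Definition ideal_lact (a : R) (x : ideal_sub) : ideal_sub :=
  IdealSub (introT (asboolP _) (idealMl a (ideal_valP x))).
Definition ideal_ract (x : ideal_sub) (a : R) : ideal_sub :=
  IdealSub (introT (asboolP _) (idealMr a (ideal_valP x))).

Fact ideal_bimodP : is_bimod ideal_lact ideal_ract.
Proof.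
split=> *; apply: val_inj => /=;
by rewrite ?raddfD /= ?mul1r ?mulr1 ?mulrA ?mulrDl ?mulrDr.
Qed.
Definition ideal_bimod : bimod R R := Bimod ideal_bimodP.

Definition in_square : {pred ideal_sub} :=
  fun x => `[< ideal_exp I 2 (ideal_val x) >].

Fact in_square_closed : zmod_closed in_square.
Proof.
split; first by rewrite unfold_in; apply/asboolP; exact: ideal0.
by move=> x y; rewrite !unfold_in => /asboolP hx /asboolP hy; apply/asboolP; exact: idealB.
Qed.
HB.instance Definition _ := GRing.isZmodClosed.Build ideal_sub in_square
  in_square_closed.
Definition square_zmodc := GRing.ZmodClosed.clone ideal_sub in_square _.

Local Open Scope quotient_scope.
Definition cotangent : Type := Quotient.quot square_zmodc.
HB.instance Definition _ := GRing.Zmodule.on cotangent.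

Definition cot_pi (x : ideal_sub) : cotangent :=
  \pi_(Quotient.quot square_zmodc) x.
Definition cot_repr (x : cotangent) : ideal_sub :=
  repr (x : Quotient.quot square_zmodc).

Lemma cot_reprK x : cot_pi (cot_repr x) = x.
Proof. exact: reprK. Qed.

Lemma cot_piP x y :
  cot_pi x = cot_pi y <-> ideal_exp I 2 (ideal_val x - ideal_val y).
Proof.
split=> [/eqP|h].
  by rewrite /cot_pi -Quotient.idealrBE => /asboolP.
by apply/eqP; rewrite /cot_pi -Quotient.idealrBE; exact/asboolP.
Qed.

Lemma cot_piB : zmod_morphism cot_pi.
Proof. by move=> x y; rewrite /cot_pi !piE. Qed.
HB.instance Definition _ :=
  GRing.isZmodMorphism.Build ideal_sub cotangent cot_pi cot_piB.

Definition cot_lactR (a : R) (x : cotangent) : cotangent :=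
  cot_pi (ideal_lact a (cot_repr x)).
Definition cot_ractR (x : cotangent) (a : R) : cotangent :=
  cot_pi (ideal_ract (cot_repr x) a).

Lemma cot_lactRE a x : cot_lactR a (cot_pi x) = cot_pi (ideal_lact a x).
Proof.
apply/cot_piP => /=; rewrite -mulrBr; apply: (@idealMl _ (ideal_exp I 2)).
by apply/cot_piP; rewrite cot_reprK.
Qed.
Lemma cot_ractRE a x : cot_ractR (cot_pi x) a = cot_pi (ideal_ract x a).
Proof.
apply/cot_piP => /=; rewrite -mulrBl; apply: (@idealMr _ (ideal_exp I 2)).
by apply/cot_piP; rewrite cot_reprK.
Qed.

Fact cot_bimodRP : is_bimod cot_lactR cot_ractR.
Proof.
have [h1 h2 h3 h4 h5 h6 h7 h8 h9] := ideal_bimodP.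
split.
- by move=> v; rewrite -(cot_reprK v) cot_lactRE h1.
- by move=> a b v; rewrite -(cot_reprK v) !cot_lactRE h2.
- by move=> a b v; rewrite -(cot_reprK v) !cot_lactRE h3 raddfD.
- move=> a v w; rewrite -(cot_reprK v) -(cot_reprK w) -raddfD !cot_lactRE.
  by rewrite h4 raddfD.
- by move=> v; rewrite -(cot_reprK v) cot_ractRE h5.
- by move=> v a b; rewrite -(cot_reprK v) !cot_ractRE h6.
- by move=> v a b; rewrite -(cot_reprK v) !cot_ractRE h7 raddfD.
- move=> v w a; rewrite -(cot_reprK v) -(cot_reprK w) -raddfD !cot_ractRE.
  by rewrite h8 raddfD.
- by move=> a v b; rewrite -(cot_reprK v) !(cot_ractRE, cot_lactRE) h9.
Qed.
Definition cot_bimodR : bimod R R := Bimod cot_bimodRP.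

Definition cot_lact (a : rquot I) (x : cotangent) : cotangent :=
  cot_lactR (rquot_repr a) x.
Definition cot_ract (x : cotangent) (a : rquot I) : cotangent :=
  cot_ractR x (rquot_repr a).

Lemma ideal_exp2M x y : I x -> I y -> ideal_exp I 2 (x * y).
Proof.
move=> Ix Iy; apply: sub_zspan; exists x, y; split => //.
by apply: sub_zspan; exists y, 1; rewrite mulr1.
Qed.

Lemma cot_lactE a x : cot_lact (rquot_pi I a) x = cot_lactR a x.
Proof.
rewrite -(cot_reprK x) /cot_lact !cot_lactRE; apply/cot_piP => /=.
rewrite -mulrBl; apply: ideal_exp2M; last exact: ideal_valP.
by apply/rquot_piP; rewrite rquot_reprK.
Qed.
Lemma cot_ractE a x : cot_ract x (rquot_pi I a) = cot_ractR x a.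
Proof.
rewrite -(cot_reprK x) /cot_ract !cot_ractRE; apply/cot_piP => /=.
rewrite -mulrBr; apply: ideal_exp2M; first exact: ideal_valP.
by apply/rquot_piP; rewrite rquot_reprK.
Qed.

Fact cot_bimodP : is_bimod cot_lact cot_ract.
Proof.
have [h1 h2 h3 h4 h5 h6 h7 h8 h9] := cot_bimodRP.
split.
- by move=> v; rewrite -(rmorph1 (rquot_pi I)) cot_lactE h1.
- move=> a b v; rewrite -(rquot_reprK a) -(rquot_reprK b) -rmorphM.
  by rewrite !cot_lactE h2.
- move=> a b v; rewrite -(rquot_reprK a) -(rquot_reprK b) -raddfD.
  by rewrite !cot_lactE h3.
- by move=> a v w; rewrite -(rquot_reprK a) !cot_lactE h4.
- by move=> v; rewrite -(rmorph1 (rquot_pi I)) cot_ractE h5.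
- move=> v a b; rewrite -(rquot_reprK a) -(rquot_reprK b) -rmorphM.
  by rewrite !cot_ractE h6.
- move=> v a b; rewrite -(rquot_reprK a) -(rquot_reprK b) -raddfD.
  by rewrite !cot_ractE h7.
- by move=> v w a; rewrite -(rquot_reprK a) !cot_ractE h8.
- move=> a v b; rewrite -(rquot_reprK a) -(rquot_reprK b).
  by rewrite !(cot_ractE, cot_lactE) h9.
Qed.
Definition cot_bimod : bimod (rquot I) (rquot I) := Bimod cot_bimodP.

End IdealBimodules.

Section TensorProduct.
Variables (A D B : pzRingType) (M : bimod A D) (N : bimod D B).

(* the free abelian group on M x N, and the relations defining M (x)_D N *)
Local Notation free := {freeg (bim_car M * bim_car N) / int}.

Definition tens_rel : set free := [set z |
  [\/ exists m m' n, z = << (m + m', n) >> - << (m, n) >> - << (m', n) >>,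
      exists m n n', z = << (m, n + n') >> - << (m, n) >> - << (m, n') >> |
      exists m d n, z = << (bim_r m d, n) >> - << (m, bim_l d n) >> ]].

Definition tens_zmodc := GRing.ZmodClosed.clone free (zspanb tens_rel) _.

Local Open Scope quotient_scope.
Definition tens_car : Type := Quotient.quot tens_zmodc.
HB.instance Definition _ := GRing.Zmodule.on tens_car.

Definition tens_pi (x : free) : tens_car := \pi_(Quotient.quot tens_zmodc) x.
Definition tens_repr (x : tens_car) : free :=
  repr (x : Quotient.quot tens_zmodc).

Definition telem (m : M) (n : N) : tens_car := tens_pi << (m, n) >>.

Lemma tens_reprK x : tens_pi (tens_repr x) = x. Proof. exact: reprK. Qed.

Lemma tens_piP x y : tens_pi x = tens_pi y <-> zspan tens_rel (x - y).
Proof.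
split=> [/eqP|h].
  by rewrite /tens_pi -Quotient.idealrBE => /asboolP.
by apply/eqP; rewrite /tens_pi -Quotient.idealrBE; exact/asboolP.
Qed.

Lemma tens_piB : zmod_morphism tens_pi.
Proof. by move=> x y; rewrite /tens_pi !piE. Qed.
HB.instance Definition _ := GRing.isZmodMorphism.Build free tens_car tens_pi
  tens_piB.

Lemma telemDl m m' n : telem (m + m') n = telem m n + telem m' n.
Proof.
rewrite /telem -raddfD; apply/tens_piP; apply: sub_zspan.
by apply: Or31; exists m, m', n; rewrite opprD addrA.
Qed.
Lemma telemDr m n n' : telem m (n + n') = telem m n + telem m n'.
Proof.
rewrite /telem -raddfD; apply/tens_piP; apply: sub_zspan.
by apply: Or32; exists m, n, n'; rewrite opprD addrA.
Qed.
Lemma telemM m d n : telem (bim_r m d) n = telem m (bim_l d n).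
Proof.
by apply/tens_piP; apply: sub_zspan; apply: Or33; exists m, d, n.
Qed.

Lemma tens_ind (P : tens_car -> Prop) : P 0 ->
  (forall x y, P x -> P y -> P (x - y)) -> (forall m n, P (telem m n)) ->
  forall x, P x.
Proof.
move=> P0 PB Pe x; rewrite -(tens_reprK x) -(freeg_sumE (tens_repr x)).
have PN u : P u -> P (- u) by move=> ?; rewrite -sub0r; apply: PB.
have PD u v : P u -> P v -> P (u + v).
  by move=> ? /PN ?; rewrite -[v]opprK; apply: PB.
rewrite raddf_sum; apply: (big_ind P) => // -[m n] _.
set c := coeff _ _; rewrite -[c]intz -freegU_mulz raddfMz -/(telem m n).
case: c => k.
  rewrite -pmulrn; elim: k => [|k IH]; first by rewrite mulr0n.
  by rewrite mulrS; exact: (PD _ _ (Pe m n) IH).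
rewrite NegzE mulrNz -pmulrn; apply: PN.
elim: k => [|k IH]; first by rewrite mulr1n; exact: Pe.
by rewrite mulrS; exact: (PD _ _ (Pe m n) IH).
Qed.

(* the additive map M (x)_D N -> V with m (x) n |-> f m n, for a biadditive   *)
(* D-balanced f; see tlift_elem                                               *)
Section Lift.
Variables (V : zmodType) (f : M -> N -> V).

Definition free_lift (x : free) : V :=
  fglift (fun z : M * N => f z.1 z.2 : zmodule V) x.
Definition tlift (x : tens_car) : V := free_lift (tens_repr x).

Lemma free_liftB : zmod_morphism free_lift.
Proof.
exact: (@lift_is_additive int _ (zmodule V) (fun z : M * N => f z.1 z.2)).
Qed.

Hypothesis fDl : forall m m' n, f (m + m') n = f m n + f m' n.
Hypothesis fDr : forall m n n', f m (n + n') = f m n + f m n'.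
Hypothesis fM : forall m d n, f (bim_r m d) n = f m (bim_l d n).

Lemma free_liftU m n : free_lift << (m, n) >> = f m n.
Proof. by rewrite /free_lift liftU scale1r. Qed.

Lemma free_lift_rel x : zspan tens_rel x -> free_lift x = 0.
Proof.
move=> hx; apply: (hx (fun x => free_lift x = 0)).
- by rewrite -(subrr 0) free_liftB subrr.
- by move=> u v hu hv; rewrite free_liftB hu hv subrr.
- move=> _ [[m [m' [n ->]]]|[m [n [n' ->]]]|[m [d [n ->]]]];
  rewrite !free_liftB !free_liftU.
  + by rewrite fDl -addrA -opprD subrr.
  + by rewrite fDr -addrA -opprD subrr.
  + by rewrite fM subrr.
Qed.

Lemma tlift_pi x : tlift (tens_pi x) = free_lift x.
Proof.
apply/eqP; rewrite -subr_eq0 -free_liftB; apply/eqP/free_lift_rel.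
by apply/tens_piP; rewrite tens_reprK.
Qed.

Lemma tlift_elem m n : tlift (telem m n) = f m n.
Proof. by rewrite tlift_pi free_liftU. Qed.

Lemma tliftB : zmod_morphism tlift.
Proof.
move=> x y; rewrite -(tens_reprK x) -(tens_reprK y) -raddfB !tlift_pi.
exact: free_liftB.
Qed.

End Lift.

Definition tens_l (a : A) : tens_car -> tens_car :=
  tlift (fun m n => telem (bim_l a m) n).
Definition tens_r (x : tens_car) (b : B) : tens_car :=
  tlift (fun m n => telem m (bim_r n b)) x.

Lemma tens_lE a m n : tens_l a (telem m n) = telem (bim_l a m) n.
Proof.
have hM := bimP M; have hN := bimP N.
rewrite /tens_l tlift_elem // => *.
- by rewrite (bim_lDr hM) telemDl.
- by rewrite telemDr.
- by rewrite (bim_lr hM) telemM.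
Qed.
Lemma tens_rE b m n : tens_r (telem m n) b = telem m (bim_r n b).
Proof.
have hM := bimP M; have hN := bimP N.
rewrite /tens_r tlift_elem // => *.
- by rewrite telemDl.
- by rewrite (bim_rDl hN) telemDr.
- by rewrite telemM (bim_lr hN).
Qed.
Lemma tens_lB a : zmod_morphism (tens_l a).
Proof.
have hM := bimP M; have hN := bimP N.
apply: tliftB => *.
- by rewrite (bim_lDr hM) telemDl.
- by rewrite telemDr.
- by rewrite (bim_lr hM) telemM.
Qed.
Lemma tens_rB b : zmod_morphism (tens_r^~ b).
Proof.
have hM := bimP M; have hN := bimP N.
apply: tliftB => *.
- by rewrite telemDl.
- by rewrite (bim_rDl hN) telemDr.
- by rewrite telemM (bim_lr hN).
Qed.

Lemma tens_ext (V : zmodType) (f g : tens_car -> V) :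
  zmod_morphism f -> zmod_morphism g ->
  (forall m n, f (telem m n) = g (telem m n)) -> f =1 g.
Proof.
move=> fB gB fg; apply: tens_ind => //.
- by rewrite -(subrr 0) fB gB !subrr.
- by move=> x y hx hy; rewrite fB gB hx hy.
Qed.

Lemma zmod_morphismD (V W : zmodType) (f : V -> W) :
  zmod_morphism f -> forall x y, f (x + y) = f x + f y.
Proof.
move=> fB x y; have f0 : f 0 = 0 by rewrite -(subrr 0) fB subrr.
by rewrite -{1}[y]opprK fB -[- y]sub0r fB f0 sub0r opprK.
Qed.

Fact tens_bimodP : is_bimod tens_l tens_r.
Proof.
have hM := bimP M; have hN := bimP N.
have cB (U V W : zmodType) (f : V -> W) (g : U -> V) : zmod_morphism f ->
  zmod_morphism g -> zmod_morphism (fun x => f (g x)).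
  by move=> fB gB x y; rewrite gB fB.
have aB (U V : zmodType) (f g : U -> V) : zmod_morphism f ->
  zmod_morphism g -> zmod_morphism (fun x => f x + g x).
  by move=> fB gB x y; rewrite gB fB opprD addrACA.
have lB := tens_lB; have rB := tens_rB.
have idB : zmod_morphism (fun x : tens_car => x) by [].
split.
- apply: (tens_ext (lB _) idB) => m n.
  by rewrite tens_lE (bim_l1 hM).
- move=> a b; apply: (tens_ext (lB _) (cB _ _ _ _ _ (lB _) (lB _))) => m n.
  by rewrite !tens_lE (bim_lM hM).
- move=> a b; apply: (tens_ext (lB _) (aB _ _ _ _ (lB _) (lB _))) => m n.
  by rewrite !tens_lE (bim_lDl hM) telemDl.
- by move=> a; apply: zmod_morphismD.
- apply: (tens_ext (rB _) idB) => m n.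
  by rewrite tens_rE (bim_r1 hN).
- move=> v a b; move: v.
  apply: (tens_ext (rB _) (cB _ _ _ _ _ (rB _) (rB _))) => m n.
  by rewrite !tens_rE (bim_rM hN).
- move=> v a b; move: v.
  apply: (tens_ext (rB _) (aB _ _ _ _ (rB _) (rB _))) => m n.
  by rewrite !tens_rE (bim_rDr hN) telemDr.
- by move=> v w a; apply: (zmod_morphismD (rB a)).
- move=> a v b; move: v.
  apply: (tens_ext (cB _ _ _ _ _ (lB _) (rB _))
                   (cB _ _ _ _ _ (rB _) (lB _))) => m n.
  by rewrite !(tens_rE, tens_lE).
Qed.

Definition tens : bimod A B := Bimod tens_bimodP.

End TensorProduct.

Section TensorPowers.
Variables (D : pzRingType) (M : bimod D D).

(* tpow n = M^(n) : M^(0) = D, M^(1) = M, M^(n+2) = M (x)_D M^(n+1) *)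
Fixpoint tpowS (n : nat) : bimod D D :=
  if n is n'.+1 then tens M (tpowS n') else M.
Definition tpow (n : nat) : bimod D D :=
  if n is n'.+1 then tpowS n' else regular_bimod D.

(* m, y |-> m (x) y, with M (x)_D D identified with M when n = 0 *)
Definition tcons n : M -> tpow n -> tpow n.+1 :=
  match n return M -> tpow n -> tpow n.+1 with
  | 0 => fun m d => bim_r m d
  | n'.+1 => fun m y => telem m y
  end.

(* the multiplication M^(m) x M^(n) -> M^(m+n) given by the tensor product;   *)
(* see tmul_cons                                                              *)
Fixpoint tmulS m n : tpow m.+1 -> tpow n -> tpow (m.+1 + n) :=
  match m return tpow m.+1 -> tpow n -> tpow (m.+1 + n) with
  | 0 => fun x y => tcons x y
  | m'.+1 => fun x y =>
      tlift (fun (a : M) (x' : tpow m'.+1) => tcons a (tmulS x' y)) x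
  end.
Definition tmul m n : tpow m -> tpow n -> tpow (m + n) :=
  match m return tpow m -> tpow n -> tpow (m + n) with
  | 0 => fun d y => bim_l (d : D) y
  | m'.+1 => @tmulS m' n
  end.

Lemma tconsDl n (a b : M) (y : tpow n) :
  tcons (a + b) y = tcons a y + tcons b y.
Proof. by case: n y => [|n] y /=; [rewrite (bim_rDl (bimP M))|exact: telemDl]. Qed.
Lemma tconsDr n (a : M) (y z : tpow n) :
  tcons a (y + z) = tcons a y + tcons a z.
Proof. by case: n y z => [|n] y z /=; [rewrite (bim_rDr (bimP M))|exact: telemDr]. Qed.
Lemma tconsM n (a : M) d (y : tpow n) :
  tcons (bim_r a d) y = tcons a (bim_l d y).
Proof. by case: n y => [|n] y /=; [rewrite (bim_rM (bimP M))|exact: telemM]. Qed.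
Lemma tcons_l n (a : M) d (y : tpow n) :
  tcons (bim_l d a) y = bim_l d (tcons a y).
Proof.
by case: n y => [|n] y /=; [rewrite (bim_lr (bimP M))|rewrite tens_lE].
Qed.
Lemma tcons_r n (a : M) d (y : tpow n) :
  tcons a (bim_r y d) = bim_r (tcons a y) d.
Proof.
by case: n y => [|n] y /=; [rewrite (bim_rM (bimP M))|rewrite tens_rE].
Qed.

Lemma tcons_ind n (P : tpow n.+1 -> Prop) : P 0 ->
  (forall x y, P x -> P y -> P (x - y)) ->
  (forall a (y : tpow n), P (tcons a y)) -> forall x, P x.
Proof.
case: n P => [|n] P P0 PB Pc x; last exact: (tens_ind P0 PB Pc).
by rewrite -(bim_r1 (bimP M) x); exact: (Pc x (1 : D)).
Qed.

Lemma tpow_ind (P : forall n, tpow n -> Prop) :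
  (forall n, P n 0) -> (forall n x y, P n x -> P n y -> P n (x - y)) ->
  (forall d : D, P 0 (d : tpow 0)) ->
  (forall n a (y : tpow n), P n y -> P n.+1 (tcons a y)) ->
  forall n x, P n x.
Proof.
move=> P0 PB Pd Pc; elim=> [|n IH] x; first exact: Pd.
apply: (@tcons_ind n (P n.+1)) => //; first exact: PB.
by move=> a y; apply: Pc; apply: IH.
Qed.

Lemma tmulS_props m n : (forall x y (z : tpow n),
    @tmulS m n (x + y) z = tmulS x z + tmulS y z) /\
  (forall d x (z : tpow n), @tmulS m n (bim_l d x) z = bim_l d (tmulS x z)) /\
  (forall (a : M) (x : tpow m) (z : tpow n),
    tmulS (tcons a x) z = tcons a (tmul x z)).
Proof.
elim: m => [|m [IHD [IHl IHc]]].
  split; [|split] => /=.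
  - by move=> x y z; exact: tconsDl.
  - by move=> d x z; exact: tcons_l.
  - by move=> a x z; exact: tconsM.
pose g (z : tpow n) (a : M) (x : tpow m.+1) := tcons a (tmulS x z).
have gDl z a b x : g z (a + b) x = g z a x + g z b x by exact: tconsDl.
have gDr z a x y : g z a (x + y) = g z a x + g z a y.
  by rewrite /g IHD tconsDr.
have gM z a d x : g z (bim_r a d) x = g z a (bim_l d x).
  by rewrite /g IHl tconsM.
have E (a : M) (x : tpow m.+1) (z : tpow n) :
    tmulS (tcons a x) z = tcons a (tmul x z).
  exact: (tlift_elem (gDl z) (gDr z) (gM z)).
have S (z : tpow n) : zmod_morphism (fun x => @tmulS m.+1 n x z).
  exact: (tliftB (gDl z) (gDr z) (gM z)).
split; [|split] => //.
- by move=> x y z; apply: (zmod_morphismD (S z)).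
- move=> d x z; have lB k : zmod_morphism (@bim_l _ _ (tpow k) d).
    by move=> u v; apply/eqP; rewrite eq_sym subr_eq -(bim_lDr (bimP _)) subrK.
  apply: (@tens_ext _ _ _ M (tpow m.+1) (tpow (m.+2 + n))
    (fun x => tmulS (bim_l d (x : tpow m.+2)) z)
    (fun x => bim_l d (tmulS (x : tpow m.+2) z))).
  + move=> u v.
    exact: (etrans (congr1 (@tmulS m.+1 n ^~ z) (lB m.+2 u v)) (S z _ _)).
  + move=> u v.
    exact: (etrans (congr1 (bim_l d) (S z u v)) (lB (m.+2 + n)%N _ _)).
  + move=> a u.
    have -> : bim_l d (telem a u : tpow m.+2) = tcons (n := m.+1) (bim_l d a) u.
      exact: tens_lE.
    by rewrite E tcons_l -E.
Qed.

Lemma tmulDl m n (x y : tpow m) (z : tpow n) :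
  tmul (x + y) z = tmul x z + tmul y z.
Proof.
case: m x y => [|m] x y; first exact: (bim_lDl (bimP (tpow n))).
exact: (tmulS_props m n).1.
Qed.
Lemma tmul_cons m n (a : M) (x : tpow m) (z : tpow n) :
  tmul (tcons a x) z = tcons a (tmul x z).
Proof. exact: (tmulS_props m n).2.2. Qed.
Lemma tmul_l m n d (x : tpow m) (z : tpow n) :
  tmul (bim_l d x) z = bim_l d (tmul x z).
Proof.
case: m x => [|m] x; first exact: (bim_lM (bimP (tpow n))).
exact: (tmulS_props m n).2.1.
Qed.

Lemma tmul0l m n (z : tpow n) : tmul (0 : tpow m) z = 0.
Proof. by apply: (addrI (tmul 0 z)); rewrite -tmulDl !addr0. Qed.
Lemma tmulNl m n (x : tpow m) (z : tpow n) : tmul (- x) z = - tmul x z.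
Proof. by apply/eqP; rewrite -addr_eq0 -tmulDl addNr tmul0l. Qed.
Lemma tmulBl m n (x y : tpow m) (z : tpow n) :
  tmul (x - y) z = tmul x z - tmul y z.
Proof. by rewrite tmulDl tmulNl. Qed.

Lemma tmulDr m n (x : tpow m) (y z : tpow n) :
  tmul x (y + z) = tmul x y + tmul x z.
Proof.
elim/tpow_ind: x => {m} [m|m x x' hx hx'|d|m a x IH].
- by rewrite !tmul0l addr0.
- by rewrite !tmulBl hx hx' opprD addrACA.
- exact: (bim_lDr (bimP (tpow n))).
- by rewrite !tmul_cons IH tconsDr.
Qed.
Lemma tmul0r m n (x : tpow m) : tmul x (0 : tpow n) = 0.
Proof. by apply: (addrI (tmul x 0)); rewrite -tmulDr !addr0. Qed.

End TensorPowers.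

Section TensorAlgebra.
Variables (D : pzRingType) (M : bimod D D).
Local Notation tpow := (tpow M).

(* T(D, M), the direct sum of the M^(n): families with finite support *)
Record tens_alg := TensAlg {
  ta_comp :> forall n, tpow n;
  _ : `[< exists N, forall n, (N <= n)%N -> ta_comp n = 0 >] }.
HB.instance Definition _ := [isSub for ta_comp].
HB.instance Definition _ := [Choice of tens_alg by <:].

Lemma ta_bounded (f : tens_alg) : exists N, forall n, (N <= n)%N -> f n = 0.
Proof. by case: f => f /= /asboolP. Qed.

Lemma ta_ext (f g : tens_alg) : (forall n, f n = g n) -> f = g.
Proof. by move=> fg; apply: val_inj; apply: functional_extensionality_dep. Qed.

Fact ta_zero_subproof :
  `[< exists N, forall n, (N <= n)%N -> (fun n => 0 : tpow n) n = 0 >].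
Proof. by apply/asboolP; exists 0. Qed.
Definition ta_zero := TensAlg ta_zero_subproof.

Fact ta_opp_subproof (f : tens_alg) :
  `[< exists N, forall n, (N <= n)%N -> (fun n => - f n) n = 0 >].
Proof.
apply/asboolP; have [N hN] := ta_bounded f; exists N => n /hN ->.
by rewrite oppr0.
Qed.
Definition ta_opp f := TensAlg (ta_opp_subproof f).

Fact ta_add_subproof (f g : tens_alg) :
  `[< exists N, forall n, (N <= n)%N -> (fun n => f n + g n) n = 0 >].
Proof.
apply/asboolP; have [N hN] := ta_bounded f; have [N' hN'] := ta_bounded g.
exists (maxn N N') => n; rewrite geq_max => /andP[/hN -> /hN' ->].
by rewrite addr0.
Qed.
Definition ta_add f g := TensAlg (ta_add_subproof f g).

Fact ta_addA : associative ta_add.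
Proof. by move=> f g h; apply: ta_ext => n /=; rewrite addrA. Qed.
Fact ta_addC : commutative ta_add.
Proof. by move=> f g; apply: ta_ext => n /=; rewrite addrC. Qed.
Fact ta_add0 : left_id ta_zero ta_add.
Proof. by move=> f; apply: ta_ext => n /=; rewrite add0r. Qed.
Fact ta_addN : left_inverse ta_zero ta_opp ta_add.
Proof. by move=> f; apply: ta_ext => n /=; rewrite addNr. Qed.
HB.instance Definition _ :=
  GRing.isZmodule.Build tens_alg ta_addA ta_addC ta_add0 ta_addN.

Lemma ta_sumE I (r : seq I) (P : pred I) (F : I -> tens_alg) n :
  (\sum_(i <- r | P i) F i) n = \sum_(i <- r | P i) F i n.
Proof. by elim/big_rec2: _ => // i x y _ <-. Qed.

(* the n-th component of x : M^(m), seen as an element of the direct sum *)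
Definition hcomp m n (x : tpow m) : tpow n :=
  match @eqP _ m n with
  | ReflectT e => ecast i (tpow i) e x
  | ReflectF _ => 0
  end.

Lemma hcomp_id m (x : tpow m) : hcomp m x = x.
Proof. by rewrite /hcomp; case: eqP => // e; rewrite (eq_axiomK e). Qed.
Lemma hcomp_neq m n (x : tpow m) : m != n -> hcomp n x = 0.
Proof. by rewrite /hcomp; case: eqP. Qed.
Lemma hcompD m n (x y : tpow m) : hcomp n (x + y) = hcomp n x + hcomp n y.
Proof.
have [<-|mn] := eqVneq m n; first by rewrite !hcomp_id.
by rewrite !hcomp_neq // addr0.
Qed.
Lemma hcomp0 m n : hcomp n (0 : tpow m) = 0.
Proof. by apply: (addrI (hcomp n (0 : tpow m))); rewrite -hcompD !addr0. Qed.

Fact ta_in_subproof m (x : tpow m) :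
  `[< exists N, forall n, (N <= n)%N -> (fun n => hcomp n x) n = 0 >].
Proof.
by apply/asboolP; exists m.+1 => n mn; rewrite hcomp_neq // ltn_eqF.
Qed.
Definition ta_in m (x : tpow m) : tens_alg := TensAlg (ta_in_subproof x).

Definition ta_mul_comp (f g : tens_alg) (n : nat) : tpow n :=
  \sum_(i < n.+1) \sum_(j < n.+1 | (i + j == n)%N) hcomp n (tmul (f i) (g j)).

Fact ta_mul_subproof (f g : tens_alg) :
  `[< exists N, forall n, (N <= n)%N -> ta_mul_comp f g n = 0 >].
Proof.
apply/asboolP; have [N hN] := ta_bounded f; have [N' hN'] := ta_bounded g.
exists (N + N')%N => n le_n; apply: big1 => i _; apply: big1 => j /eqP ij.
have [/hN ->|iN] := leqP N i; first by rewrite tmul0l hcomp0.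
have [/hN' ->|jN] := leqP N' j; first by rewrite tmul0r hcomp0.
have : (N + N' <= i + j)%N := leq_trans le_n (eq_leq (esym ij)).
by rewrite leqNgt -addSn leq_add // ltnW.
Qed.
Definition ta_mul f g := TensAlg (ta_mul_subproof f g).
Definition ta_one := ta_in (m := 0) (1 : D).

Fact ta_mulDl : left_distributive ta_mul +%R.
Proof.
move=> f g h; apply: ta_ext => n /=; rewrite /ta_mul_comp -big_split /=.
apply: eq_bigr => i _; rewrite -big_split; apply: eq_bigr => j _ /=.
by rewrite tmulDl hcompD.
Qed.
Fact ta_mulDr : right_distributive ta_mul +%R.
Proof.
move=> f g h; apply: ta_ext => n /=; rewrite /ta_mul_comp -big_split /=.
apply: eq_bigr => i _; rewrite -big_split; apply: eq_bigr => j _ /=.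
by rewrite tmulDr hcompD.
Qed.

Lemma ta_in_decomp (f : tens_alg) : exists N, f = \sum_(i < N) ta_in (f i).
Proof.
have [N hN] := ta_bounded f; exists N; apply: ta_ext => n.
rewrite ta_sumE /=; have [Nn|nN] := leqP N n.
  rewrite hN // big1 // => i _; rewrite hcomp_neq //.
  by rewrite neq_ltn (leq_trans (ltn_ord i) Nn).
rewrite (bigD1 (Ordinal nN)) //= hcomp_id big1 ?addr0 // => i ni.
by rewrite hcomp_neq.
Qed.

Lemma ta_inD m (x y : tpow m) : ta_in (x + y) = ta_in x + ta_in y.
Proof. by apply: ta_ext => n /=; rewrite hcompD. Qed.

Lemma ta_inM m n (x : tpow m) (y : tpow n) :
  ta_mul (ta_in x) (ta_in y) = ta_in (tmul x y).
Proof.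
apply: ta_ext => N /=; rewrite /ta_mul_comp /=.
have [<-|mnN] := eqVneq (m + n)%N N; last first.
  rewrite [RHS]hcomp_neq //; apply: big1 => i _; apply: big1 => j /eqP ij.
  have [mi|mi] := eqVneq m i; last by rewrite (hcomp_neq x) // tmul0l hcomp0.
  have [nj|nj] := eqVneq n j; first by rewrite -mi -nj in ij; rewrite ij eqxx in mnN.
  by rewrite (hcomp_neq y) // tmul0r hcomp0.
have hm : (m < (m + n).+1)%N by rewrite ltnS leq_addr.
have hn : (n < (m + n).+1)%N by rewrite ltnS leq_addl.
rewrite (bigD1 (Ordinal hm)) //= [X in _ + X]big1 ?addr0; last first.
  move=> i ni; apply: big1 => j _; rewrite (hcomp_neq x) ?tmul0l ?hcomp0 //.
  by rewrite eq_sym.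
rewrite (bigD1 (Ordinal hn)) //= [X in _ + X]big1 ?addr0; last first.
  move=> j /andP[_ nj]; rewrite (hcomp_neq y) ?tmul0r ?hcomp0 //.
  by rewrite eq_sym.
by rewrite !hcomp_id.
Qed.

Lemma ta_mul_suml I (r : seq I) (F : I -> tens_alg) g :
  ta_mul (\sum_(i <- r) F i) g = \sum_(i <- r) ta_mul (F i) g.
Proof.
elim: r => [|i r IH]; last by rewrite !big_cons ta_mulDl IH.
rewrite !big_nil; apply: (addrI (ta_mul 0 g)).
by rewrite -ta_mulDl !addr0.
Qed.
Lemma ta_mul_sumr I (r : seq I) (F : I -> tens_alg) g :
  ta_mul g (\sum_(i <- r) F i) = \sum_(i <- r) ta_mul g (F i).
Proof.
elim: r => [|i r IH]; last by rewrite !big_cons ta_mulDr IH.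
rewrite !big_nil; apply: (addrI (ta_mul g 0)).
by rewrite -ta_mulDr !addr0.
Qed.

Lemma ta_inB m (x y : tpow m) : ta_in (x - y) = ta_in x - ta_in y.
Proof. by apply: (addIr (ta_in y)); rewrite -ta_inD !subrK. Qed.

Lemma ta_in0 m : ta_in (0 : tpow m) = 0.
Proof. by rewrite -(subrr 0) ta_inB subrr. Qed.

Lemma ta_in_tcons m n (a : M) (x : tpow m) (y : tpow n) :
  ta_in x = ta_in y -> ta_in (tcons a x) = ta_in (tcons a y).
Proof.
pose shift (f : tens_alg) k : tpow k :=
  match k return tpow k with 0 => 0 | k'.+1 => tcons a (f k') end.
have shiftE k (u : tpow k) i : ta_in (tcons a u) i = shift (ta_in u) i.
  case: i => [|i] /=; first by rewrite hcomp_neq.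
  have [<-|ki] := eqVneq k i; first by rewrite !hcomp_id.
  rewrite !hcomp_neq ?eqSS //; apply: (addrI (tcons a 0)).
  by rewrite -tconsDr !addr0.
by move=> xy; apply: ta_ext => i; rewrite !shiftE xy.
Qed.

Lemma ta_in_mulA m n p (x : tpow m) (y : tpow n) (z : tpow p) :
  ta_in (tmul (tmul x y) z) = ta_in (tmul x (tmul y z)).
Proof.
elim/tpow_ind: x => {m} [m|m x x' hx hx'|d|m a x IH].
- by rewrite !tmul0l !ta_in0.
- by rewrite !tmulBl !ta_inB hx hx'.
- by rewrite /= tmul_l.
- by rewrite !tmul_cons; exact: ta_in_tcons.
Qed.

Lemma ta_in_mul1 m (x : tpow m) :
  ta_in (tmul x ((1 : D) : tpow 0)) = ta_in x.
Proof.
elim/tpow_ind: x => {m} [m|m x x' hx hx'|d|m a x IH].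
- by rewrite !tmul0l !ta_in0.
- by rewrite !tmulBl !ta_inB hx hx'.
- by congr ta_in; exact: mulr1.
- by rewrite !tmul_cons; exact: ta_in_tcons.
Qed.

Fact ta_mulA : associative ta_mul.
Proof.
move=> f g h.
have [Nf ->] := ta_in_decomp f; rewrite !ta_mul_suml; apply: eq_bigr => i _.
have [Ng ->] := ta_in_decomp g.
rewrite ta_mul_suml !ta_mul_sumr ta_mul_suml; apply: eq_bigr => j _.
have [Nh ->] := ta_in_decomp h; rewrite !ta_mul_sumr; apply: eq_bigr => l _.
by rewrite !ta_inM ta_in_mulA.
Qed.

Fact ta_mul1l : left_id ta_one ta_mul.
Proof.
move=> f; have [N ->] := ta_in_decomp f; rewrite ta_mul_sumr.
by apply: eq_bigr => i _; rewrite ta_inM; congr ta_in; exact: (bim_l1 (bimP _)).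
Qed.

Fact ta_mul1r : right_id ta_one ta_mul.
Proof.
move=> f; have [N ->] := ta_in_decomp f; rewrite ta_mul_suml.
by apply: eq_bigr => i _; rewrite ta_inM ta_in_mul1.
Qed.

HB.instance Definition _ := GRing.Zmodule_isPzRing.Build tens_alg
  ta_mulA ta_mul1l ta_mul1r ta_mulDl ta_mulDr.

Fact ta_augP : is_ideal (fun f : tens_alg => f 0%N = 0).
Proof.
have c0 (f g : tens_alg) : (f * g) 0%N = (f 0%N : D) * (g 0%N : D).
  by rewrite [LHS]big_ord1 big_mkcond big_ord1 /= hcomp_id.
do ![split] => //.
- by move=> f g f0 g0; rewrite /= f0 g0; exact: subrr.
- by move=> a f f0; rewrite (c0 a f) f0; exact: mulr0.
- by move=> f a f0; rewrite (c0 f a) f0; exact: mul0r.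
Qed.

(* J, the direct sum of the M^(n) for n >= 1 *)
Definition ta_aug : ideal tens_alg := Ideal ta_augP.

End TensorAlgebra.

(* finite direct sums, realised as finite products *)
Section DirectSum.
Variables (I : finType) (V : I -> zmodType).

Definition dsum : Type := {dffun forall i : I, V i}.
HB.instance Definition _ := Choice.on dsum.

Definition dsum_add (f g : dsum) : dsum := [ffun i => f i + g i].
Definition dsum_opp (f : dsum) : dsum := [ffun i => - f i].
Definition dsum_zero : dsum := [ffun i => 0].

Fact dsum_addA : associative dsum_add.
Proof. by move=> f g h; apply/ffunP => i; rewrite !ffunE addrA. Qed.
Fact dsum_addC : commutative dsum_add.
Proof. by move=> f g; apply/ffunP => i; rewrite !ffunE addrC. Qed.
Fact dsum_add0 : left_id dsum_zero dsum_add.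
Proof. by move=> f; apply/ffunP => i; rewrite !ffunE add0r. Qed.
Fact dsum_addN : left_inverse dsum_zero dsum_opp dsum_add.
Proof. by move=> f; apply/ffunP => i; rewrite !ffunE addNr. Qed.
HB.instance Definition _ :=
  GRing.isZmodule.Build dsum dsum_addA dsum_addC dsum_add0 dsum_addN.

Lemma dsumDE (f g : dsum) i : (f + g) i = f i + g i.
Proof. by rewrite [LHS]ffunE. Qed.

Definition dsum_in i (v : V i) : dsum := [ffun j => dfwith (fun j => 0 : V j) v j].

End DirectSum.

Record species (k : fieldType) := Species {
  sp_vertex : finType;
  sp_div : sp_vertex -> falgType k;
  (* sp_mod j i is the D_j-D_i-bimodule jMi *)
  sp_mod : sp_vertex -> sp_vertex -> vectType k;
  sp_lact : forall j i, sp_div j -> sp_mod j i -> sp_mod j i;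
  sp_ract : forall j i, sp_mod j i -> sp_div i -> sp_mod j i;
  sp_divP : forall i (x : sp_div i), x != 0 -> x \is a GRing.unit;
  sp_modP : forall j i, is_bimod (@sp_lact j i) (@sp_ract j i);
  sp_lscale : forall j i c (m : sp_mod j i), sp_lact c%:A m = c *: m;
  sp_rscale : forall j i c (m : sp_mod j i), sp_ract m c%:A = c *: m }.

Section SpeciesTensorAlgebra.
Variables (k : fieldType) (S : species k).
Local Notation I := (sp_vertex S).

(* D, the direct sum of the D_i, with componentwise multiplication *)
Definition sp_D : Type := dsum (@sp_div k S).
HB.instance Definition _ := GRing.Zmodule.on sp_D.

Definition spD_one : sp_D := [ffun i => 1].
Definition spD_mul (x y : sp_D) : sp_D := [ffun i => x i * y i].

Fact spD_mulA : associative spD_mul.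
Proof. by move=> f g h; apply/ffunP => i; rewrite !ffunE mulrA. Qed.
Fact spD_mul1l : left_id spD_one spD_mul.
Proof. by move=> f; apply/ffunP => i; rewrite !ffunE mul1r. Qed.
Fact spD_mul1r : right_id spD_one spD_mul.
Proof. by move=> f; apply/ffunP => i; rewrite !ffunE mulr1. Qed.
Fact spD_mulDl : left_distributive spD_mul +%R.
Proof. by move=> f g h; apply/ffunP => i; rewrite !(ffunE, dsumDE) mulrDl. Qed.
Fact spD_mulDr : right_distributive spD_mul +%R.
Proof. by move=> f g h; apply/ffunP => i; rewrite !(ffunE, dsumDE) mulrDr. Qed.
HB.instance Definition _ := GRing.Zmodule_isPzRing.Build sp_D
  spD_mulA spD_mul1l spD_mul1r spD_mulDl spD_mulDr.

Definition spD_scalar (c : k) : sp_D := [ffun i => c%:A].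

(* M, the direct sum of the jMi, indexed by the pairs p = (j, i) *)
Definition sp_M : Type := dsum (fun p : I * I => @sp_mod k S p.1 p.2).
HB.instance Definition _ := GRing.Zmodule.on sp_M.

Definition spM_l (d : sp_D) (m : sp_M) : sp_M :=
  [ffun p => sp_lact (d p.1) (m p)].
Definition spM_r (m : sp_M) (d : sp_D) : sp_M :=
  [ffun p => sp_ract (m p) (d p.2)].

Fact sp_bimodP : is_bimod spM_l spM_r.
Proof.
split=> *; apply/ffunP => p; rewrite !(ffunE, dsumDE).
- exact: (bim_l1 (sp_modP _ _)).
- exact: (bim_lM (sp_modP _ _)).
- exact: (bim_lDl (sp_modP _ _)).
- exact: (bim_lDr (sp_modP _ _)).
- exact: (bim_r1 (sp_modP _ _)).
- exact: (bim_rM (sp_modP _ _)).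
- exact: (bim_rDr (sp_modP _ _)).
- exact: (bim_rDl (sp_modP _ _)).
- exact: (bim_lr (sp_modP _ _)).
Qed.
Definition sp_bimod : bimod sp_D sp_D := Bimod sp_bimodP.

Definition sp_tens : pzRingType := tens_alg sp_bimod.

Definition spT_scalar (c : k) : sp_tens :=
  ta_in (M := sp_bimod) (m := 0) (spD_scalar c).

(* the inclusion of jMi in T(S), in degree 1 *)
Definition spT_arrow (j i : I) (m : sp_mod j i) : sp_tens :=
  ta_in (M := sp_bimod) (m := 1)
    (dsum_in (V := fun p : I * I => @sp_mod k S p.1 p.2) (i := (j, i)) m).

(* there is an arrow i -> j in the underlying quiver *)
Definition sp_arrow (i j : I) : Prop := exists m : sp_mod j i, m != 0.

(* elementary tensors g_n (x) ... (x) g_1, n >= 1, along a path from a to b;  *)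
(* the multiplication of T(S) is the tensor product                           *)
Inductive elem_tensor (a : I) : I -> sp_tens -> Prop :=
| ElemTensor1 b (g : sp_mod b a) :
    sp_arrow a b -> elem_tensor a b (spT_arrow g)
| ElemTensorS b c (g : sp_mod c b) (t : sp_tens) :
    sp_arrow b c -> elem_tensor a b t -> elem_tensor a c (spT_arrow g * t).

(* sigma = g_1 + ... + g_n, n >= 1, is a relation from a to b *)
Definition is_relation (a b : I) (sigma : sp_tens) : Prop :=
  exists n (g : 'I_n.+1 -> sp_tens),
    (forall l, elem_tensor a b (g l)) /\ sigma = \sum_l g l.

Definition relation_set (rho : set sp_tens) : Prop :=
  forall sigma, rho sigma -> exists a b, is_relation a b sigma.

End SpeciesTensorAlgebra.

Section Algebras.
Variables (k : fieldType) (L : falgType k).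
Local Notation r := (jacobson_rad L).

(* left submodules of L; they are automatically k-subspaces *)
Definition lsubmod (U : {vspace L}) : Prop := forall a u, u \in U -> a * u \in U.

(* isomorphism of left L-modules; a k-linear map on U extends to L *)
Definition lsubmod_iso (U V : {vspace L}) : Prop :=
  exists f : 'End(L), [/\ (f @: U = V)%VS, (U :&: lker f = 0)%VS &
    forall a u, u \in U -> f (a * u) = a * f u].

Definition lsubmod_indec (U : {vspace L}) : Prop :=
  [/\ lsubmod U, U != 0%VS & forall V W, lsubmod V -> lsubmod W ->
    (V + W = U)%VS -> (V :&: W = 0)%VS -> V = 0%VS \/ W = 0%VS].

(* L is a direct sum of pairwise non-isomorphic indecomposable left modules,  *)
(* which are projective because they are direct summands of L                 *)
Definition basic_algebra : Prop :=
  exists n (P : 'I_n -> {vspace L}),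
  [/\ forall i, lsubmod_indec (P i),
      (\sum_i P i = fullv)%VS, directv (\sum_i P i) &
      forall i j, i != j -> ~ lsubmod_iso (P i) (P j)].

Definition split_section (eps : {rmorphism rquot r -> L}) : Prop :=
  (forall c : k, eps (rquot_pi r c%:A) = c%:A) /\
  (forall x, rquot_pi r (eps x) = x).

Definition split_algebra : Prop := exists eps, split_section eps.

(* 0 -> r^2 -> r -> r/r^2 -> 0 splits over L/r, acting via eps *)
Definition rad_splits (eps : {rmorphism rquot r -> L}) : Prop :=
  exists s : {additive cotangent r -> ideal_sub r},
  [/\ forall x, cot_pi (s x) = x,
      forall d x, s (cot_lactR (eps d) x) = ideal_lact (eps d) (s x) &
      forall x d, s (cot_ractR x (eps d)) = ideal_ract (s x) (eps d)].

Definition rsplit_algebra : Prop :=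
  split_algebra /\ forall eps, split_section eps -> rad_splits eps.

(* S is the species of L: theta identifies the direct sum of the D_i with     *)
(* L/r, and eta j i identifies jMi with D_j (r/r^2) D_i                       *)
Definition species_of (S : species k) : Prop :=
  exists (theta : {rmorphism sp_D S -> rquot r})
         (eta : forall j i, {additive @sp_mod k S j i -> cotangent r}),
  let D_in i (d : sp_div i) : rquot r :=
    theta (dsum_in (V := @sp_div k S) d) in
  [/\ bijective theta, forall c, theta (spD_scalar S c) = rquot_pi r c%:A &
   forall j i,
    [/\ injective (eta j i),
        range (eta j i) = zspan [set y | exists d x d',
          y = cot_ract (cot_lact (D_in j d) x) (D_in i d')] &
        forall d m d', eta j i (sp_ract (sp_lact d m) d') =
          cot_ract (cot_lact (D_in j d) (eta j i m)) (D_in i d')]].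

End Algebras.

(* Main.v *)
Require Import Defs.
From HB Require Import structures.
From mathcomp Require Import all_boot all_order all_algebra all_field.
From mathcomp Require Import boolp classical_sets.

(* Jacobson radical: an element x such that every a * x is nilpotent lies in r,
   and r is nilpotent by Nakayama's lemma.

   Existence of the species: the decomposition of L into indecomposable left
   ideals gives orthogonal idempotents e_i.  By Fitting's lemma an element of
   e_i L e_i is nilpotent or left invertible, and since the summands are
   pairwise non-isomorphic this puts e_i L e_j in r for i <> j and makes the
   image of e_i L e_i in L/r a division ring.  The D_i and jMi are realised
   inside L through the sections eps of L -> L/r and s of r -> r/r^2.

   Presentation: eps and s induce a ring morphism F : T(S) -> L, injective in
   degrees 0 and 1 modulo r and r^2.  Hence ker F is contained in J^2; it
   contains J^rl because F maps J into r.  F is onto because D and M generate L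
   modulo each power of the nilpotent ideal r.  The kernel is generated by the
   relations it contains: e_b f e_a is zero or a relation from a to b as soon as
   f has no component in degree 0. *)

Set Implicit Arguments.
Unset Strict Implicit.
Unset Printing Implicit Defensive.

Import GRing.Theory.
Local Open Scope ring_scope.
Local Open Scope classical_set_scope.

(** * The radical of a finite dimensional algebra *)

Section IdealPowers.
Variables (R : pzRingType) (I : ideal R).

Lemma ideal_exp1 x : ideal_exp I 1 x <-> I x.
Proof.
split=> [hx|Ix]; last by apply: sub_zspan; exists x, 1; rewrite mulr1.
apply: (hx I); first exact: ideal0.
- by move=> u v; apply: (@idealB _ I).
- by move=> _ [u [v [Iu _ ->]]]; apply: (@Defs.idealMr _ I).
Qed.

Lemma ideal_expS n x y : I x -> ideal_exp I n y -> ideal_exp I n.+1 (x * y).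
Proof. by move=> Ix Iy; apply: sub_zspan; exists x, y. Qed.

Lemma ideal_expS_ind n (X : set R) : X 0 ->
  (forall x y, X x -> X y -> X (x - y)) ->
  (forall x y, I x -> ideal_exp I n y -> X (x * y)) ->
  ideal_exp I n.+1 `<=` X.
Proof.
move=> X0 XB XM z hz; apply: (hz X) => // _ [x [y [Ix Iy ->]]].
exact: XM.
Qed.

Lemma ideal_expSW n : ideal_exp I n.+1 `<=` ideal_exp I n.
Proof.
apply: ideal_expS_ind; first exact: ideal0.
- by move=> u v; apply: (@idealB _ (ideal_exp I n)).
- by move=> x y _; apply: (@idealMl _ (ideal_exp I n)).
Qed.

Lemma ideal_expD m n x y :
  ideal_exp I m x -> ideal_exp I n y -> ideal_exp I (m + n) (x * y).
Proof.
move=> + In; elim: m x => [|m IH] x; first by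
  move=> _; apply: (@idealMl _ (ideal_exp I n)).
move=> Ix; apply: (@ideal_expS_ind m (fun x => ideal_exp I (m.+1 + n) (x * y))) Ix.
- by rewrite mul0r; apply: (@ideal0 _ (ideal_exp I _)).
- by move=> u v hu hv; rewrite mulrBl; apply: (@idealB _ (ideal_exp I _)).
- by move=> u v hu hv; rewrite -mulrA addSn; apply: ideal_expS => //; apply: IH.
Qed.

Lemma ideal_exp_le m n : (m <= n)%N -> ideal_exp I n `<=` ideal_exp I m.
Proof.
move=> mn; rewrite -(subnK mn); elim: (n - m)%N => // l IH.
by apply: subset_trans IH; apply: ideal_expSW.
Qed.

End IdealPowers.

(** A subspace contained in [X] of maximal dimension is all of [X]: adjoining the line through
    another element of [X] stays inside [X], hence cannot raise the dimension. *)
Lemma subspace_vspace (k : fieldType) (V : vectType k) (X : set V) :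
  X 0 -> (forall c u v, X u -> X v -> X (c *: u + v)) ->
  exists U : {vspace V}, forall v, v \in U <-> X v.
Proof.
move=> X0 XL.
pose inX d :=
  `[< exists U : {vspace V}, (forall v, v \in U -> X v) /\ \dim U = d >].
have inX0 : exists d, inX d.
  exists 0%N; apply/asboolP; exists 0%VS; split; last exact: dimv0.
  by move=> v; rewrite memv0 => /eqP->.
have inXle d : inX d -> (d <= \dim {:V})%N.
  by move=> /asboolP[U [_ <-]]; rewrite dimvS // subvf.
case: (ex_maxnP inX0 inXle) => d /asboolP[U [UX <-]] dmax.
exists U => v; split=> [|Xv]; first exact: UX.
have /dmax le : inX (\dim (U + <[v]>)).
  apply/asboolP; exists (U + <[v]>)%VS; split=> // w /memv_addP[u Uu [w0 + ->]].
  by move=> /vlineP[c ->]; rewrite addrC; apply: XL => //; apply: UX.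
have /eqP UE : U == (U + <[v]>)%VS by rewrite eqEdim addvSl.
by rewrite UE -{1}[v]add0r memv_add ?mem0v ?memv_line.
Qed.

Section FiniteDimensional.
Variables (k : fieldType) (L : falgType k).
Implicit Types (U V W : {vspace L}).
Local Notation r := (jacobson_rad L).

(** Scalars act as left multiplication by [c%:A], so additive closure and absorption already give
    linearity. This makes dimension arguments available for left ideals. *)
Lemma lideal_vspace (X : set L) : is_lideal X ->
  exists2 U : {vspace L}, lsubmod U & forall v, v \in U <-> X v.
Proof.
move=> [[X0 XB] XM].
have XN u : X u -> X (- u) by move=> Xu; rewrite -sub0r; apply: XB.
have [//|c u v Xu Xv|U UX] := @subspace_vspace k L X.
  rewrite -[v]opprK; apply: XB; last exact: XN.
  by rewrite -mulr_algl; apply: XM.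
by exists U => // a u /UX Xu; apply/UX/XM.
Qed.

Lemma ideal_vspace (I : ideal L) :
  exists2 U : {vspace L}, lsubmod U & forall v, v \in U <-> I v.
Proof. by apply: lideal_vspace; case: (ideal_memP I). Qed.

(** Finite dimension replaces Zorn's lemma: a proper submodule above [W] of largest dimension is
    maximal. *)
Lemma max_lsubmod U W : lsubmod W -> (W <= U)%VS -> W != U ->
  exists V, [/\ lsubmod V, (W <= V)%VS, (V <= U)%VS, V != U &
    forall V', lsubmod V' -> (V <= V')%VS -> (V' <= U)%VS -> V' = V \/ V' = U].
Proof.
move=> Wm WU neWU.
pose P d := `[< exists V, [/\ lsubmod V, (W <= V)%VS, (V <= U)%VS, V != U &
   \dim V = d] >].
have P0 : exists d, P d by exists (\dim W); apply/asboolP; exists W.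
have Ple d : P d -> (d <= \dim U)%N.
  by move=> /asboolP[V [_ _ VU _ <-]]; apply: dimvS.
case: (ex_maxnP P0 Ple) => d /asboolP[V [Vm WV VU neVU <-]] dmax.
exists V; split=> // V' V'm VV' V'U.
have [->|neV'U] := eqVneq V' U; [by right|left].
apply/esym/eqP; rewrite eqEdim VV' dmax //; apply/asboolP.
by exists V'; split=> //; apply: subv_trans VV'.
Qed.

Lemma lsubmod0 : lsubmod (0%VS : {vspace L}).
Proof. by move=> a u; rewrite !memv0 => /eqP->; rewrite mulr0. Qed.

Lemma lsubmod_amulr U x : lsubmod U -> lsubmod (amulr x @: U)%VS.
Proof.
move=> Um a _ /memv_imgP[y Uy ->]; rewrite lfunE /= mulrA.
have -> : a * y * x = amulr x (a * y) by rewrite lfunE.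
by apply: memv_img; apply: Um.
Qed.

Lemma lsubmodD U V : lsubmod U -> lsubmod V -> lsubmod (U + V)%VS.
Proof.
move=> Um Vm a _ /memv_addP[u Uu [v Vv ->]].
by rewrite mulrDr memv_add ?Um ?Vm.
Qed.

Lemma lsubmodf : lsubmod {:L}. Proof. by move=> a u _; apply: memvf. Qed.

Lemma lsubmod_lideal U : lsubmod U -> is_lideal [set v | v \in U].
Proof.
move=> Um; do ![split] => //=; first exact: mem0v.
by move=> x y; apply: memvB.
Qed.

(** If the left ideal generated by [1 - x] were proper, a maximal left ideal above it would contain
    [x] as well, hence [1]. *)
Lemma rad_linv x : r x -> exists y, y * (1 - x) = 1.
Proof.
move=> rx; have Wm : lsubmod (limg (amulr (1 - x))) := lsubmod_amulr lsubmodf.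
have [/memv_imgP[y _ yE]|n1] := boolP (1 \in limg (amulr (1 - x))).
  by exists y; rewrite [RHS]yE lfunE.
have [|V [Vm WV _ neV Vmax]] := max_lsubmod Wm (subvf _).
  by apply: contraNneq n1 => ->; apply: memvf.
have V1 : 1 \notin V.
  apply: contraNN neV => V1; rewrite eqEsubv subvf; apply/subvP => v _.
  by rewrite -[v]mulr1; apply: Vm.
have : r `<=` [set v | v \in V].
  move=> z; apply; split; first exact: lsubmod_lideal.
    by move=> /= V1'; rewrite V1' in V1.
  move=> J Jl VJ; have [V' V'm V'E] := lideal_vspace Jl.
  have <- : [set v | v \in V'] = J by apply/seteqP; split=> v /V'E.
  have VV' : (V <= V')%VS by apply/subvP => v Vv; apply/V'E/VJ.
  have [->|->] := Vmax V' V'm VV' (subvf _); first by left.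
  by right; apply/seteqP; split=> // v _; apply: memvf.
move=> /(_ x rx) /= Vx; case/negP: V1; rewrite -(subrK x 1) memvD //.
apply: (subvP WV); apply/memv_imgP.
by exists 1; rewrite ?memvf // lfunE /= mul1r.
Qed.

(** If a maximal left ideal [I] omits [x], then [I + L x] is everything, so [1 = u + a * x] with [u]
    in [I]. Nilpotency of [a * x] then forces [1] into [I]. *)
Lemma nil_rad x : (forall a, exists n, (a * x) ^+ n = 0) -> r x.
Proof.
move=> xnil I [[[I0 IB] IM] I1 Imax].
have ID u v : I u -> I v -> I (u + v).
  by move=> Iu Iv; rewrite -[v]opprK; apply: (IB) => //; rewrite -sub0r; apply: IB.
have [//|nIx] := pselect (I x).
pose J := [set z | exists u a, I u /\ z = u + a * x].
have Jl : is_lideal J.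
  do ![split].
  - by exists 0, 0; rewrite mul0r addr0.
  - move=> _ _ [u [a [Iu ->]]] [v [b [Iv ->]]]; exists (u - v), (a - b).
    by rewrite mulrBl opprD addrACA; split=> //; apply: IB.
  - move=> a _ [u [b [Iu ->]]]; exists (a * u), (a * b).
    by rewrite mulrDr mulrA; split=> //; apply: IM.
have [|JI|JT] := Imax J Jl.
- by move=> u Iu; exists u, 0; rewrite mul0r addr0.
- by case: nIx; rewrite -JI; exists 0, 1; rewrite mul1r add0r.
have [u [a [Iu E]]] : J 1 by rewrite JT.
have [n nE] := xnil a; case: I1.
(* This holds for every exponent: since [u = 1 - a * x], passing from [n] to [n.+1] adds
   [(a * x) ^+ n * u], an element of [I]. *)
suff : I (1 - (a * x) ^+ n) by rewrite nE subr0.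
elim: n {nE} => [|n IH]; first by rewrite expr0 subrr.
have -> : 1 - (a * x) ^+ n.+1 = 1 - (a * x) ^+ n + (a * x) ^+ n * u.
  have -> : u = 1 - a * x by rewrite E addrK.
  by rewrite mulrBr mulr1 -exprSr addrA subrK.
by apply: ID => //; apply: IM.
Qed.

(* Nakayama's lemma for submodules of L: if x * u escapes a maximal proper
   submodule V, then u = v + a * x * u with v in V, and 1 - a * x is left
   invertible. *)
Lemma rad_mul_full U : lsubmod U ->
  (forall u, u \in U ->
     zspan [set z | exists x v, [/\ r x, v \in U & z = x * v]] u) ->
  U = 0%VS.
Proof.
move=> Um Ufull; apply/eqP; apply: contraT; rewrite eq_sym => neU.
have [V [Vm _ VU neVU Vmax]] := max_lsubmod lsubmod0 (sub0v U) neU.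
have rV x u : r x -> u \in U -> x * u \in V.
  move=> rx Uu; have [//|nVxu] := boolP (x * u \in V).
  pose V' := (V + amulr (x * u) @: fullv)%VS.
  have V'E : V' = U.
    case: (Vmax V') => //; first exact: lsubmodD Vm (lsubmod_amulr lsubmodf).
    - exact: addvSl.
    - rewrite subv_add VU; apply/subvP => _ /memv_imgP[a _ ->].
      by rewrite lfunE /=; apply: (Um); apply: Um.
    move=> V'V; case/negP: nVxu; rewrite -V'V; apply: (subvP (addvSr _ _)).
    by apply/memv_imgP; exists 1; rewrite ?memvf // lfunE /= mul1r.
  move: (Uu); rewrite -V'E => /memv_addP[v Vv [_ /memv_imgP[a _ ->]]].
  rewrite lfunE /= => uE; have [y yE] := rad_linv (idealMl a rx).
  case/negP: nVxu; apply: (Vm x); rewrite -[u]mul1r -yE -mulrA; apply: (Vm y).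
  by rewrite mulrBl mul1r -mulrA {1}uE addrK.
case/negP: neVU; rewrite eqEsubv VU; apply/subvP => u.
move=> /Ufull /(_ [set v | v \in V]).
apply => /=; first exact: mem0v.
- by move=> v w; apply: memvB.
- by move=> _ [x [v [rx Uv ->]]]; apply: rV.
Qed.

(** The powers of [r] form a decreasing chain of subspaces. At one of least dimension the next power
    is the same, and [rad_mul_full] makes it zero. *)
Lemma rad_nilpotent : exists n, ideal_exp r n = [set 0] :> set L.
Proof.
have : forall n, exists U : {vspace L},
    lsubmod U /\ forall v, v \in U <-> ideal_exp r n v.
  by move=> n; have [U] := ideal_vspace (ideal_exp r n); exists U.
move=> /choice[U UP].
pose P d := `[< exists n, \dim (U n) = d >].
have P0 : exists d, P d by exists (\dim (U 0%N)); apply/asboolP; exists 0%N.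
case: (ex_minnP P0) => d /asboolP[n <-] dmin; exists n.
have US : (U n.+1 <= U n)%VS.
  by apply/subvP => v /(UP _).2 hv; apply/(UP _).2; apply: ideal_expSW.
have /eqP UE : U n.+1 == U n.
  by rewrite eqEdim US dmin //; apply/asboolP; exists n.+1.
have U0 : U n = 0%VS.
  apply: rad_mul_full => [|u]; first exact: (UP n).1.
  rewrite -{1}UE => /(UP _).2; apply: ideal_expS_ind; first exact: zspan0.
  - exact: zspanB.
  - move=> x y rx /(UP _).2 Uy; apply: sub_zspan; exists x, y; split=> //.
apply/seteqP; split=> v /=; last by move=> ->; apply: ideal0.
by move=> /(UP _).2; rewrite U0 memv0 => /eqP.
Qed.

(** Nilpotency of [r] rules out the default branch in the definition of [rad_length]. *)
Lemma ideal_exp_rad_length : ideal_exp r (rad_length L) = [set 0] :> set L.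
Proof.
rewrite /rad_length; case: pselect => [e|[]].
  by case: ex_minnP => n /asboolP.
by have [n hn] := rad_nilpotent; exists n; apply/asboolP.
Qed.

End FiniteDimensional.

(** * Idempotents of a basic algebra *)

(** Since [x = x * e], a factor [e] may be inserted after every [x]; the extra power supplies the
    leading [x] that starts this. Nilpotency of [a * x] can thus be tested in a corner. *)
Lemma nil_corner (R : pzRingType) (e a x : R) n :
  x * e = x -> (e * a * x) ^+ n = 0 -> (a * x) ^+ n.+1 = 0.
Proof.
move=> xe nil; have E m y : y * e = y -> y * (a * x) ^+ m = y * (e * a * x) ^+ m.
  elim: m y => [|m IH] y ye; first by rewrite !expr0.
  rewrite !exprS !mulrA ye; apply: IH.
  by rewrite -mulrA xe.
by rewrite exprS -mulrA E // nil !mulr0.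
Qed.

Section Basic.
Variables (k : fieldType) (L : falgType k).
Implicit Types (U V W : {vspace L}).
Local Notation r := (jacobson_rad L).

(* Fitting's lemma for right multiplication by x on the indecomposable U = Le *)
Lemma indec_nil_or_linv U e x : lsubmod_indec U -> e \in U ->
  (forall v, v \in U -> v * e = v) -> e * x = x -> x * e = x ->
  (exists n, x ^+ n = 0) \/ exists z, z * x = e.
Proof.
move=> [Um _ Uindec] Ue Ur ex xe.
have Ux : x \in U by rewrite -xe; apply: Um.
(* The powers start at [x] itself, so that [e = v * x ^+ m.+1] will exhibit [v * x ^+ m] as a left
   inverse. *)
pose f m := amulr (x ^+ m.+1).
have fE m v : f m v = v * x ^+ m.+1 by rewrite lfunE.
pose P d := `[< exists m, \dim (f m @: U)%VS = d >].
have P0 : exists d, P d by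
  exists (\dim (f 0%N @: U)%VS); apply/asboolP; exists 0%N.
case: (ex_minnP P0) => d /asboolP[m <-] dmin.
pose W := (f m @: U)%VS; pose V := (U :&: lker (f m))%VS.
(* Applying [f m] twice gives another map of the family. Since the image [W] already has least
   dimension, [f m] is injective on [W], and [U] splits as the kernel [V] plus [W]. *)
have fWE : (f m @: W = f (m + m.+1)%N @: U)%VS.
  rewrite /W -limg_comp; congr (lfun_img _ _); apply/lfunP => v.
  by rewrite comp_lfunE !fE -mulrA -exprD addSn addnS.
have WK : (W :&: lker (f m) = 0)%VS.
  apply/eqP; rewrite -dimv_eq0.
  have := limg_ker_dim (f m) W; rewrite fWE.
  have : (\dim W <= \dim (f (m + m.+1)%N @: U))%N.
    by apply: dmin; apply/asboolP; exists (m + m.+1)%N.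
  by move=> le eq; rewrite -leqn0 -(leq_add2r (\dim (f (m + m.+1)%N @: U))) eq.
have WU : (W <= U)%VS.
  apply/subvP => _ /memv_imgP[v Uv ->]; rewrite fE exprSr mulrA.
  exact: Um.
have VW : (V :&: W = 0)%VS.
  apply/eqP; rewrite -subv0 -WK /V [X in (X <= _)%VS]capvC capvA.
  by apply: capvS (subvv _); apply: capvSl.
have VWU : (V + W = U)%VS.
  have VU : (V <= U)%VS by apply: capvSl.
  apply/eqP; rewrite eqEdim subv_add VU WU (dimv_disjoint_sum VW).
  by rewrite /V /W limg_ker_dim leqnn.
have Vm : lsubmod V.
  move=> a v /memv_capP[Uv]; rewrite memv_ker fE => /eqP v0.
  by rewrite memv_cap Um // memv_ker fE -mulrA v0 mulr0 eqxx.
have [V0|W0] := Uindec V W Vm (lsubmod_amulr Um) VWU VW.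
  have /memv_imgP[v _ eE] : e \in W by rewrite -[W]add0v -V0 VWU.
  by right; exists (v * x ^+ m); rewrite -mulrA -exprSr eE fE.
left; exists m.+1; have : f m e \in W by apply: memv_img.
by rewrite W0 memv0 fE exprS mulrA ex -exprS => /eqP.
Qed.

Lemma basic_idempotents : basic_algebra L ->
  exists n (e : 'I_n -> L),
  [/\ \sum_i e i = 1, forall i, e i != 0,
      forall i j, e i * e j = if i == j then e i else 0,
      forall i j x, i != j -> r (e i * x * e j) &
      forall i x, r (e i * x * e i) \/ exists z, z * (e i * x * e i) = e i].
Proof.
move=> [n [P [Pindec Psum Pdir Piso]]].
have Pm i : lsubmod (P i) by have [] := Pindec i.
have /memv_sumP[e Pe /esym esum] : 1 \in (\sum_i P i)%VS by rewrite Psum memvf.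
(* The [e j] are the components of [1]. Both [v] placed in [P i] and the family [v * e j] decompose
   [v], so directness of the sum identifies them. *)
have eP i v j : v \in P i -> v * e j = if i == j then v else 0.
  move=> Pv.
  have : \sum_j v * e j = \sum_j (if i == j then v else 0).
    rewrite -mulr_sumr esum mulr1 (bigD1 i) //= eqxx big1 ?addr0 // => l.
    by rewrite eq_sym => /negPf->.
  move=> /eqP; have /directv_sum_unique -> := Pdir; last 2 first.
  - by move=> l _; apply: Pm; apply: Pe.
  - by move=> l _; case: eqP => [<-|_] //; apply: mem0v.
  by move=> /forall_inP/(_ j isT)/eqP.
have ee i j : e i * e j = if i == j then e i else 0 by apply: eP; apply: Pe.
have PE i v : v \in P i -> v * e i = v by move=> /eP->; rewrite eqxx.
have e0 i : e i != 0.
  have [_ neP _] := Pindec i; apply: contraNneq neP => ei0.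
  by rewrite -subv0; apply/subvP => v /PE <-; rewrite ei0 mulr0 mem0v.
have nil_linv i x : e i * x = x -> x * e i = x ->
    (exists n, x ^+ n = 0) \/ exists z, z * x = e i.
  by apply: (indec_nil_or_linv (Pindec i)) => //; [apply: Pe|apply: PE].
(* Otherwise Fitting gives [w] with [w * (u * v) = e i], and right multiplication by [e i * w * u]
   becomes an isomorphism from [P i] to [P j] with inverse right multiplication by [v]. *)
have corner_nil i j u v : i != j -> e i * u = u -> u * e j = u ->
    e j * v = v -> v * e i = v -> exists n, (u * v) ^+ n = 0.
  move=> ij eu ue ev ve.
  have [||//|[w wE]] := nil_linv i (u * v).
  - by rewrite mulrA eu.
  - by rewrite -mulrA ve.
  (* [q] is an idempotent of the [j]-th corner. If nilpotent it would vanish and kill [e i]; left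
     invertible, it must equal [e j], which is the other half of the isomorphism. *)
  pose q := v * (e i * w * u).
  have qq : q * q = q.
    rewrite /q -!mulrA (mulrA u v) (mulrA w) wE.
    by rewrite !(mulrA (e i) (e i), ee, eqxx).
  have ejq : e j * q = q by rewrite /q !mulrA ev.
  have qej : q * e j = q by rewrite /q -!mulrA ue.
  have [[m qm]|[t tq]] := nil_linv j q ejq qej.
    have qS l : q ^+ l.+1 = q.
      by elim: l => [|l IH]; rewrite ?expr1 // exprS IH qq.
    have q0 : q = 0 by rewrite -(qS m) exprS qm mulr0.
    case/negP: (e0 i); apply/eqP.
    have -> : e i = w * u * q * v.
      rewrite /q -!mulrA wE ee eqxx (mulrA u) (mulrA w) wE.
      by rewrite ee eqxx.
    by rewrite q0 mulr0 mul0r.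
  have qE : q = e j by rewrite -[LHS]ejq -tq -mulrA qq.
  case: (Piso i j ij); exists (amulr (e i * w * u)); split.
  - apply/eqP; rewrite eqEsubv; apply/andP; split; apply/subvP => p.
      move=> /memv_imgP[p' _ ->]; rewrite lfunE /= -ue !mulrA.
      by apply: Pm; apply: Pe.
    move=> Pp; apply/memv_imgP; exists (p * v).
      by rewrite -ve mulrA; apply: Pm; apply: Pe.
    by rewrite lfunE /= -[RHS]mulrA -/q qE PE.
  - apply/eqP; rewrite -subv0; apply/subvP => p /memv_capP[Pp].
    rewrite memv_ker lfunE /= => /eqP p0; rewrite memv0 -(PE i p Pp).
    have -> : e i = e i * w * u * v by rewrite -!mulrA wE ee eqxx.
    by rewrite mulrA p0 mul0r.
  - by move=> a p _; rewrite !lfunE /= (mulrA a).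
exists n, e; split=> // [i j x ij|i x].
  (* By [nil_corner] it suffices to treat [e j * a * e i * y], a product of two opposite
     off-diagonal corner elements. *)
  apply: nil_rad => a; set y := e i * x * e j.
  have ey : e i * y = y by rewrite /y !mulrA ee eqxx.
  have ye : y * e j = y by rewrite /y -!mulrA ee eqxx.
  have [|||||m nil] := @corner_nil j i (e j * a * e i) y.
  - by rewrite eq_sym.
  - by rewrite !mulrA ee eqxx.
  - by rewrite -!mulrA ee eqxx.
  - by [].
  - by [].
  by exists m.+1; apply: (nil_corner ye); rewrite -ey mulrA.
set y := e i * x * e i.
have ey : e i * y = y by rewrite /y !mulrA ee eqxx.
have ye : y * e i = y by rewrite /y -!mulrA ee eqxx.
(* When [y] has no left inverse, no multiple [e i * a * y] has one either, so all of these are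
   nilpotent. *)
have [|nz] := pselect (exists z, z * y = e i); [by right|left].
apply: nil_rad => a; have [||[m nil]|[z zE]] := nil_linv i (e i * a * y).
- by rewrite !mulrA ee eqxx.
- by rewrite -mulrA ye.
- by exists m.+1; apply: nil_corner nil.
- by case: nz; exists (z * (e i * a)); rewrite -mulrA.
Qed.

End Basic.

(** * The species of a split algebra *)

Lemma big_dsum_in (I : finType) (V : I -> zmodType) (W : zmodType)
    (f : forall j, V j -> W) i (v : V i) : (forall j, f j 0 = 0) ->
  \sum_j f j (dsum_in v j) = f i v.
Proof.
move=> f0; rewrite (bigD1 i) //= /dsum_in ffunE dfwith_in.
by rewrite big1 ?addr0 // => j ji; rewrite ffunE dfwith_out // eq_sym.
Qed.

Lemma dsum_in_eq (I : finType) (V : I -> zmodType) i (v : V i) :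
  dsum_in v i = v.
Proof. by rewrite ffunE dfwith_in. Qed.

Lemma dsum_in_neq (I : finType) (V : I -> zmodType) i j (v : V i) :
  i != j -> dsum_in v j = 0.
Proof. by move=> ij; rewrite ffunE dfwith_out. Qed.

Section SpeciesOfSection.
Variables (k : fieldType) (L : falgType k).
Local Notation r := (jacobson_rad L).
Variable eps : {rmorphism rquot r -> L}.
Variable s : {additive cotangent r -> ideal_sub r}.
Hypothesis eps_split : split_section eps.
Hypothesis sK : forall x, cot_pi (s x) = x.
Hypothesis s_l : forall d x, s (cot_lactR (eps d) x) = ideal_lact (eps d) (s x).
Hypothesis s_r : forall x d, s (cot_ractR x (eps d)) = ideal_ract (s x) (eps d).
Variables (n : nat) (e : 'I_n -> L).
Hypothesis sum_e : \sum_i e i = 1.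
Hypothesis e_neq0 : forall i, e i != 0.
Hypothesis eM : forall i j, e i * e j = if i == j then e i else 0.
Hypothesis e_rad : forall i j x, i != j -> r (e i * x * e j).
Hypothesis e_linv : forall i x,
  r (e i * x * e i) \/ exists z, z * (e i * x * e i) = e i.

Local Notation phi x := (eps (rquot_pi r x)).
Local Notation E i := (phi (e i)).

Let phi_scal (c : k) : phi c%:A = c%:A. Proof. by have [-> _] := eps_split. Qed.
Let epsK x : rquot_pi r (eps x) = x. Proof. by have [_ ->] := eps_split. Qed.

Let phiM x y : phi (x * y) = phi x * phi y. Proof. by rewrite !rmorphM. Qed.
Let phiZD c u v : phi (c *: u + v) = c *: phi u + phi v.
Proof. by rewrite -[c *: u]mulr_algl !rmorphD phiM phi_scal mulr_algl. Qed.

Let EM i j : E i * E j = if i == j then E i else 0.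
Proof. by rewrite -phiM eM; case: eqP; rewrite ?rmorph0. Qed.

Let sumE : \sum_i E i = 1.
Proof.
rewrite -[RHS](rmorph1 eps) -[X in eps X](rmorph1 (rquot_pi r)) -sum_e.
by rewrite !raddf_sum.
Qed.

Let phi_eq0 x : phi x = 0 <-> r x.
Proof.
split=> [x0|rx].
  have : rquot_pi r x = rquot_pi r 0 by rewrite -[LHS]epsK x0.
  by move=> /rquot_piP; rewrite subr0.
have -> : rquot_pi r x = rquot_pi r 0 by apply/rquot_piP; rewrite subr0.
by rewrite !rmorph0.
Qed.

Let E_neq0 i : E i != 0.
Proof.
apply/eqP => /phi_eq0 /rad_linv[y yE]; case/negP: (e_neq0 i).
by rewrite -[e i]mul1r -yE -mulrA mulrBl mul1r eM eqxx subrr mulr0.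
Qed.

(** The block is the corner of [eps (L/r)] at [E i], written as the fixed points of a linear map so
    that it is a subspace. It is a unital algebra with unit [E i] rather than [1]. *)
Lemma vertex_block_ex i : exists A : {aspace L},
  forall v, v \in A <-> E i * phi v * E i = v.
Proof.
have [||A AE] := @subspace_vspace k L [set v | E i * phi v * E i = v].
- by rewrite /= !rmorph0 mulr0 mul0r.
- move=> c u v /= uE vE.
  by rewrite phiZD mulrDr mulrDl -scalerAr -scalerAl uE vE.
have AM u : E i * phi u * E i = u -> E i * u = u /\ u * E i = u /\ phi u = u.
  move=> <-; rewrite !mulrA EM eqxx -!mulrA EM eqxx; do !split=> //.
  by rewrite !phiM !epsK.
have aA : is_aspace A.
  apply/andP; split.
    apply/has_algidP; exists (E i); split.
    - by apply/AE; rewrite /= epsK EM eqxx EM eqxx.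
    - exact: E_neq0.
    - by move=> v /AE /AM[-> [-> _]].
  apply/prodvP => u v /AE /AM[Eu [_ pu]] /AE /AM[_ [vE pv]].
  by apply/AE; rewrite /= phiM pu pv mulrA Eu -mulrA vE.
by exists (ASpace aA).
Qed.

Definition vertex_block i : {aspace L} := sval (cid (vertex_block_ex i)).
Local Notation A := vertex_block.

Lemma vertex_blockP i v :
  v \in A i -> [/\ E i * v = v, v * E i = v & phi v = v].
Proof.
rewrite /A; case: (cid _) => B /= BE /BE <-.
by rewrite !mulrA EM eqxx -!mulrA EM eqxx !phiM !epsK.
Qed.

Lemma mem_vertex_block i x : phi (e i * x * e i) \in A i.
Proof.
rewrite /A; case: (cid _) => B /= BE; apply/BE.
by rewrite epsK !phiM !mulrA EM eqxx -!mulrA EM eqxx.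
Qed.

Let E_block i : E i \in A i.
Proof. by have := mem_vertex_block i (e i); rewrite !eM eqxx eM eqxx. Qed.

Lemma vertex_block_one i : vsval (1 : subvs_of (A i)) = E i.
Proof.
rewrite /= -[RHS](algidl (E_block i)).
by have [_ ->] := vertex_blockP (memv_algid (A i)).
Qed.

Lemma arrow_space_ex j i : exists M : {vspace L},
  forall v, v \in M <-> exists x, v = E j * ideal_val (s x) * E i.
Proof.
apply: subspace_vspace; first by exists 0; rewrite raddf0 mulr0 mul0r.
(* The section [s] is only additive by type; its linearity over [k] comes from [s_l] at the class of
   [c%:A], which [eps] sends back to [c%:A]. *)
move=> c _ _ [x ->] [y ->]; exists (cot_lactR (eps (rquot_pi r c%:A)) x + y).
rewrite !raddfD /= s_l /= phi_scal mulr_algl mulrDr mulrDl.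
by rewrite -scalerAr -scalerAl.
Qed.

Definition arrow_space j i : {vspace L} := sval (cid (arrow_space_ex j i)).
Local Notation M := arrow_space.

Lemma arrow_spaceP j i v :
  v \in M j i <-> exists x, v = E j * ideal_val (s x) * E i.
Proof. by rewrite /M; case: (cid _). Qed.

(** Bilinearity of [s] moves both idempotents inside it. Elements of the arrow space are therefore
    values of [s]: they lie in [r] and are determined by their classes modulo [r^2]. *)
Lemma arrow_space_cot j i v :
  v \in M j i <-> exists x,
    v = ideal_val (s (cot_ractR (cot_lactR (E j) x) (E i))).
Proof.
by split=> [/arrow_spaceP[x ->]|[x ->]]; [|apply/arrow_spaceP];
   exists x; rewrite s_r s_l.
Qed.

Lemma arrow_space_l j i d v : d \in A j -> v \in M j i -> d * v \in M j i.
Proof.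
move=> /vertex_blockP[Ed dE pd] /arrow_spaceP[x ->]; apply/arrow_spaceP.
exists (cot_lactR (phi d) x); rewrite s_l /= pd !mulrA Ed.
by rewrite dE.
Qed.

Lemma arrow_space_r j i d v : d \in A i -> v \in M j i -> v * d \in M j i.
Proof.
move=> /vertex_blockP[Ed dE pd] /arrow_spaceP[x ->]; apply/arrow_spaceP.
exists (cot_ractR x (phi d)); rewrite s_r /= pd -!mulrA Ed.
by rewrite dE.
Qed.

Definition arrow_l j i (d : subvs_of (A j)) (m : subvs_of (M j i)) :=
  vsproj (M j i) (vsval d * vsval m).
Definition arrow_r j i (m : subvs_of (M j i)) (d : subvs_of (A i)) :=
  vsproj (M j i) (vsval m * vsval d).

Lemma arrow_lE j i d m : vsval (@arrow_l j i d m) = vsval d * vsval m.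
Proof. by rewrite vsprojK // arrow_space_l // subvsP. Qed.
Lemma arrow_rE j i d m : vsval (@arrow_r j i m d) = vsval m * vsval d.
Proof. by rewrite vsprojK // arrow_space_r // subvsP. Qed.

Lemma arrow_space_id j i m : m \in M j i -> E j * m = m /\ m * E i = m.
Proof.
by move=> /arrow_spaceP[x ->]; rewrite !mulrA EM eqxx -!mulrA EM eqxx.
Qed.

(** Left inverses of all nonzero elements suffice: a left inverse [y] of [d] has its own left
    inverse, which must be [d]. *)
Lemma vertex_block_unit i (d : subvs_of (A i)) :
  d != 0 -> d \is a GRing.unit.
Proof.
have linv (x : subvs_of (A i)) : x != 0 -> exists y, y * x = 1.
  move=> x0; set v := vsval x.
  have [Ev vE pv] := vertex_blockP (subvsP x).
  have pE : phi (e i * v * e i) = v by rewrite !phiM pv Ev vE.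
  (* In the first case [v], being fixed by the projection [phi] with kernel [r], would be zero. *)
  have [/phi_eq0|[z zE]] := e_linv i v.
    rewrite pE => v0; case/negP: x0; apply/eqP/subvs_inj.
    by rewrite -/v v0 linear0.
  exists (Subvs (mem_vertex_block i (e i * z))); apply: subvs_inj.
  rewrite vertex_block_one /= -/v -pE -phiM.
  have -> : e i * (e i * z) * e i * (e i * v * e i) =
      e i * (z * (e i * v * e i)).
    by rewrite !mulrA eM eqxx -(mulrA (e i * z)) eM eqxx.
  by rewrite zE eM eqxx.
move=> d0; have [y yd] := linv d d0.
have y0 : y != 0.
  apply: contraTneq (oner_neq0 (subvs_of (A i))) => y0.
  by rewrite -yd y0 mul0r eqxx.
have [z zy] := linv y y0.
have zd : z = d by rewrite -[z]mulr1 -yd mulrA zy mul1r.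
by apply/unitrP; exists y; rewrite -{2}zd.
Qed.

Lemma arrow_bimod j i : is_bimod (@arrow_l j i) (@arrow_r j i).
Proof.
split=> [v|a b v|a b v|a v w|v|v a b|v a b|v w a|a v b]; apply: subvs_inj.
- by rewrite arrow_lE vertex_block_one; have [] := arrow_space_id (subvsP v).
- by rewrite !arrow_lE mulrA.
- by rewrite linearD /= !arrow_lE linearD mulrDl.
- by rewrite linearD /= !arrow_lE linearD mulrDr.
- by rewrite arrow_rE vertex_block_one; have [] := arrow_space_id (subvsP v).
- by rewrite !arrow_rE -mulrA.
- by rewrite linearD /= !arrow_rE linearD mulrDr.
- by rewrite linearD /= !arrow_rE linearD mulrDl.
- by rewrite !(arrow_lE, arrow_rE) mulrA.
Qed.

Lemma arrow_lscale j i c (m : subvs_of (M j i)) : arrow_l c%:A m = c *: m.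
Proof.
apply: subvs_inj; rewrite arrow_lE !linearZ /= -scalerAl; congr (_ *: _).
rewrite -[RHS](arrow_space_id (subvsP m)).1; congr (_ * _).
exact: vertex_block_one.
Qed.

Lemma arrow_rscale j i c (m : subvs_of (M j i)) : arrow_r m c%:A = c *: m.
Proof.
apply: subvs_inj; rewrite arrow_rE !linearZ /= -scalerAr; congr (_ *: _).
rewrite -[RHS](arrow_space_id (subvsP m)).2; congr (_ * _).
exact: vertex_block_one.
Qed.

Definition section_species : species k :=
  @Species k 'I_n (fun i => subvs_of (A i)) (fun j i => subvs_of (M j i))
    arrow_l arrow_r vertex_block_unit arrow_bimod arrow_lscale arrow_rscale.
Local Notation S := section_species.

Definition section_theta (d : sp_D S) : rquot r :=
  rquot_pi r (\sum_i vsval (d i : subvs_of (A i))).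

Fact section_theta_is_zmod_morphism : zmod_morphism section_theta.
Proof.
move=> d d'; rewrite /section_theta -raddfB -sumrB; congr (rquot_pi r _).
apply: eq_bigr => i _; rewrite -linearB; congr vsval.
by rewrite dsumDE [(- d') i]ffunE.
Qed.
HB.instance Definition _ :=
  GRing.isZmodMorphism.Build (sp_D S) (rquot r) section_theta
    section_theta_is_zmod_morphism.

Fact section_theta_is_monoid_morphism : monoid_morphism section_theta.
Proof.
split=> [|d d'].
  rewrite /section_theta -[RHS](rmorph1 (rquot_pi r)) -sumE.
  congr (rquot_pi r _); apply: eq_bigr => i _.
  by rewrite ffunE vertex_block_one.
rewrite /section_theta -rmorphM; congr (rquot_pi r _).
rewrite mulr_suml; apply: eq_bigr => i _; rewrite mulr_sumr (bigD1 i) //=.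
rewrite ffunE big1 ?addr0 // => j ji.
have [_ <- _] := vertex_blockP (subvsP (d i : subvs_of (A i))).
have [<- _ _] := vertex_blockP (subvsP (d' j : subvs_of (A j))).
by rewrite -mulrA (mulrA (E i)) EM eq_sym (negPf ji) mul0r mulr0.
Qed.
HB.instance Definition _ :=
  GRing.isMonoidMorphism.Build (sp_D S) (rquot r) section_theta
    section_theta_is_monoid_morphism.

Lemma section_theta_in i (d : sp_div (s := S) i) :
  section_theta (dsum_in (V := @sp_div k S) d) =
  rquot_pi r (vsval (d : subvs_of (A i))).
Proof.
rewrite /section_theta; congr (rquot_pi r _).
exact: (@big_dsum_in _ _ _ (fun j (x : subvs_of (A j)) => vsval x) i d).
Qed.

(** The inverse cuts [eps x] into its diagonal corners. These add up to [eps x] because by [e_rad]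
    the off-diagonal corners come from elements of [r], which [phi] kills. *)
Lemma section_theta_bij : bijective section_theta.
Proof.
pose g (x : rquot r) : sp_D S :=
  [ffun i => Subvs (mem_vertex_block i (eps x)) : sp_div (s := S) i].
have gE x i : vsval (g x i : subvs_of (A i)) = E i * eps x * E i.
  by rewrite ffunE /= !phiM epsK.
exists g => [d|x].
  apply/ffunP => i; apply: subvs_inj; rewrite gE.
  rewrite /section_theta !raddf_sum /= mulr_sumr mulr_suml (bigD1 i) //=.
  have [Ed dE ->] := vertex_blockP (subvsP (d i : subvs_of (A i))).
  rewrite Ed dE big1 ?addr0 // => j ji.
  have [Ej _ ->] := vertex_blockP (subvsP (d j : subvs_of (A j))).
  by rewrite -Ej mulrA EM eq_sym (negPf ji) !mul0r.
rewrite -[RHS]epsK /section_theta; congr (rquot_pi r _).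
rewrite -[RHS]mulr1 -[RHS]mul1r -sumE mulr_suml; apply: eq_bigr => j _.
rewrite gE -mulrA mulr_sumr mulr_sumr (bigD1 j) //= mulrA.
rewrite big1 ?addr0 // => i ij.
have -> : E j * (eps x * E i) = phi (e j * eps x * e i).
  by rewrite !phiM epsK mulrA.
by apply/phi_eq0; apply: e_rad; rewrite eq_sym.
Qed.

Fact arrow_space_rad j i (m : subvs_of (M j i)) : idealb r (vsval m).
Proof.
apply/asboolP; have /arrow_space_cot[x ->] := subvsP m.
exact: ideal_valP.
Qed.

Definition section_eta j i (m : sp_mod (s := S) j i) : cotangent r :=
  cot_pi (IdealSub (@arrow_space_rad j i m)).

Fact section_eta_is_zmod_morphism j i : zmod_morphism (@section_eta j i).
Proof.
move=> m m'; rewrite /section_eta -raddfB; congr cot_pi.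
exact: val_inj.
Qed.
HB.instance Definition _ j i :=
  GRing.isZmodMorphism.Build (sp_mod (s := S) j i) (cotangent r)
    (@section_eta j i) (@section_eta_is_zmod_morphism j i).

(** [m] is already a value of [s], so passing to its class and lifting back returns it. Injectivity
    of [section_eta] follows. *)
Lemma section_etaK j i (m : sp_mod (s := S) j i) :
  ideal_val (s (section_eta m)) = vsval (m : subvs_of (M j i)).
Proof.
have /arrow_space_cot[x mE] := subvsP (m : subvs_of (M j i)).
rewrite [RHS]mE; congr (ideal_val (s _)); rewrite -[RHS]sK.
by congr cot_pi; apply: val_inj; rewrite /= -mE.
Qed.

Lemma section_species_of : species_of L S.
Proof.
exists section_theta, section_eta => D_in.
have DE i (d : sp_div (s := S) i) :
    D_in i d = rquot_pi r (vsval (d : subvs_of (A i))).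
  exact: section_theta_in.
split; first exact: section_theta_bij.
  move=> c; rewrite -[RHS]epsK phi_scal; congr (rquot_pi r _).
  rewrite -[RHS]mulr1 -[X in _ * X]sumE mulr_sumr.
  apply: eq_bigr => i _; rewrite ffunE linearZ /= mulr_algl.
  by congr (_ *: _); apply: vertex_block_one.
move=> j i; split.
- move=> m m' mm'; apply: subvs_inj.
  by rewrite -[LHS]section_etaK mm' section_etaK.
- apply/seteqP; split=> [_ [m _ <-]|].
    have /arrow_space_cot[x mE] := subvsP (m : subvs_of (M j i)).
    apply: sub_zspan; exists 1, x, 1; rewrite !DE !vertex_block_one.
    rewrite cot_lactE cot_ractE -[RHS]sK; congr cot_pi.
    by apply: val_inj; rewrite /= -mE.
  move=> y; apply.
  + by exists 0 => //; rewrite raddf0.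
  + by move=> _ _ [m _ <-] [m' _ <-]; exists (m - m') => //; rewrite raddfB.
  + move=> _ [d [x [d' ->]]]; rewrite !DE cot_lactE cot_ractE.
    have [Ed dE pd] := vertex_blockP (subvsP (d : subvs_of (A j))).
    have [Ed' dE' pd'] := vertex_blockP (subvsP (d' : subvs_of (A i))).
    set z := cot_ractR _ _.
    (* The witness is [z] itself: [d] and [d'] absorb the idempotents [E j] and [E i]. *)
    have zM : ideal_val (s z) \in M j i.
      apply/arrow_spaceP; exists z.
      rewrite /z -pd -pd' s_r s_l /= pd pd' !mulrA Ed -!mulrA dE'.
      by [].
    exists (Subvs zM) => //; rewrite -[RHS]sK; congr cot_pi.
    exact: val_inj.
- move=> d m d'; rewrite !DE cot_lactE cot_ractE /section_eta.
  rewrite cot_lactRE cot_ractRE; congr cot_pi; apply: val_inj => /=.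
  by rewrite arrow_rE arrow_lE.
Qed.

End SpeciesOfSection.

Lemma species_of_exists (k : fieldType) (L : falgType k) :
  basic_algebra L -> rsplit_algebra L -> exists S : species k, species_of L S.
Proof.
move=> /basic_idempotents[n [e [sum_e e_neq0 eM e_rad e_linv]]].
move=> [[eps eps_split] /(_ eps eps_split)[s [sK s_l s_r]]].
eexists.
exact: (section_species_of eps_split sK s_l s_r sum_e e_neq0 eM e_rad e_linv).
Qed.

(** * Tensor algebras *)

Section TensorAlgebraTheory.
Variables (D : pzRingType) (M : bimod D D).
Local Notation T := (tens_alg M).
Local Notation J := (ta_aug M).

Lemma ta_in_tconsE n (a : M) (y : tpow M n) :
  ta_in (tcons a y) = (ta_in (m := 1) (a : tpow M 1) : T) * ta_in y.
Proof. by rewrite [RHS]ta_inM. Qed.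

Lemma ta_in_aug n (x : tpow M n.+1) : J (ta_in x).
Proof. exact: hcomp_neq. Qed.

Lemma ta_in_aug_exp n (x : tpow M n) : ideal_exp J n (ta_in x).
Proof.
elim: n x => [//|n IH]; apply: tcons_ind => [|x y hx hy|a y].
- by rewrite ta_in0; apply: ideal0.
- by rewrite ta_inB; apply: idealB.
- by rewrite ta_in_tconsE; apply: ideal_expS => //; apply: (@ta_in_aug 0).
Qed.

Lemma ta_aug_exp2 (f : T) : f 0 = 0 -> f 1 = 0 -> ideal_exp J 2 f.
Proof.
move=> f0 f1; have [N ->] := ta_in_decomp f.
apply: (big_ind (ideal_exp J 2)); first exact: ideal0.
  by move=> x y; apply: idealD.
move=> [[|[|n]] nN] _ /=; rewrite ?f0 ?f1 ?ta_in0;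
  try exact: (@ideal0 _ (ideal_exp J 2)).
exact: (@ideal_exp_le _ J 2 n.+2 isT _ (ta_in_aug_exp _)).
Qed.

(** * Universal property of the tensor algebra *)

Section Lift.
Variables (R : pzRingType) (g0 : {rmorphism D -> R}) (g1 : {additive M -> R}).
Hypothesis g1_l : forall d a, g1 (bim_l d a) = g0 d * g1 a.
Hypothesis g1_r : forall a d, g1 (bim_r a d) = g1 a * g0 d.

Fixpoint tpowS_lift n : tpowS M n -> R :=
  match n return tpowS M n -> R with
  | 0 => g1
  | n'.+1 => tlift (fun a (y : tpowS M n') => g1 a * tpowS_lift y)
  end.

Definition tpow_lift n : tpow M n -> R :=
  match n return tpow M n -> R with 0 => g0 | n'.+1 => @tpowS_lift n' end.

(** The three facts need a joint induction: left linearity in one degree makes the product map of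
    the next degree balanced over [D], and only then do the equations for [tlift] apply. *)
Lemma tpowS_lift_props n :
  [/\ zmod_morphism (@tpowS_lift n),
      forall d (x : tpowS M n), tpowS_lift (bim_l d x) = g0 d * tpowS_lift x &
      forall a (y : tpow M n),
        @tpowS_lift n (tcons a y) = g1 a * tpow_lift y].
Proof.
elim: n => [|n [tB tl _]].
  by split; [move=> x y /=; apply: raddfB|exact: g1_l|exact: g1_r].
pose h (a : M) (y : tpowS M n) := g1 a * tpowS_lift y.
have hDl a b y : h (a + b) y = h a y + h b y by rewrite /h raddfD mulrDl.
have hDr a y z : h a (y + z) = h a y + h a z.
  by rewrite /h (zmod_morphismD tB) mulrDr.
have hM a d y : h (bim_r a d) y = h a (bim_l d y).
  by rewrite /h g1_r tl mulrA.
have hB := tliftB hDl hDr hM; have hE := tlift_elem hDl hDr hM.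
split=> // d.
pose l (x : tens M (tpowS M n)) := tpowS_lift (n := n.+1) (bim_l d x).
apply: (@tens_ext _ _ _ M (tpowS M n) R l
  (fun x => g0 d * tpowS_lift (n := n.+1) x)) => [x y|x y|a y].
- have -> : l (x - y) = tpowS_lift (n := n.+1)
      (bim_l d (x : tpowS M n.+1) - bim_l d (y : tpowS M n.+1)).
    by congr tpowS_lift; apply: tens_lB.
  exact: hB.
- by rewrite [X in _ * X]hB mulrBr.
- have -> : l (telem a y) = tpowS_lift (n := n.+1) (telem (bim_l d a) y).
    by congr tpowS_lift; apply: tens_lE.
  by rewrite [LHS]hE [X in _ * X]hE /h g1_l mulrA.
Qed.

Lemma tpow_liftB n : zmod_morphism (@tpow_lift n).
Proof. by case: n => [|n]; [apply: raddfB|have [] := tpowS_lift_props n]. Qed.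

HB.instance Definition _ n :=
  GRing.isZmodMorphism.Build (tpow M n) R (@tpow_lift n) (@tpow_liftB n).

Lemma tpow_lift_l n d (x : tpow M n) :
  tpow_lift (bim_l d x) = g0 d * tpow_lift x.
Proof.
case: n x => [|n] x; first exact: rmorphM.
by have [_ tl _] := tpowS_lift_props n; apply: tl.
Qed.

Lemma tpow_lift_cons n a (y : tpow M n) :
  tpow_lift (tcons a y) = g1 a * tpow_lift y.
Proof. by have [_ _ tc] := tpowS_lift_props n; apply: tc. Qed.

Lemma tpow_liftM m n (x : tpow M m) (y : tpow M n) :
  tpow_lift (tmul x y) = tpow_lift x * tpow_lift y.
Proof.
elim/tpow_ind: x => {m} [m|m x x' hx hx'|d|m a x IH].
- by rewrite tmul0l !raddf0 mul0r.
- by rewrite tmulBl !tpow_liftB hx hx' mulrBl.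
- exact: tpow_lift_l.
- by rewrite tmul_cons !tpow_lift_cons IH mulrA.
Qed.

Definition ta_lift (f : T) : R :=
  \sum_(i < sval (cid (ta_bounded f))) tpow_lift (f i).

(** Terms beyond the support vanish, so the bound picked by choice in [ta_lift] is immaterial and
    two elements can share one bound. *)
Lemma ta_liftE N (f : T) : (forall n, (N <= n)%N -> f n = 0) ->
  ta_lift f = \sum_(i < N) tpow_lift (f i).
Proof.
have E m n : (forall l, (m <= l)%N -> f l = 0) -> (m <= n)%N ->
    \sum_(i < m) tpow_lift (f i) = \sum_(i < n) tpow_lift (f i).
  move=> fm mn; rewrite (big_ord_widen n (fun i => tpow_lift (f i)) mn).
  rewrite big_mkcond; apply: eq_bigr => i _.
  by case: ltnP => // /fm ->; rewrite raddf0.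
rewrite /ta_lift; case: cid => N' /= fN' fN.
by have [le|/ltnW le] := leqP N' N; [apply: E|apply/esym/E].
Qed.

Fact ta_lift_is_zmod_morphism : zmod_morphism ta_lift.
Proof.
move=> f g; have [N fN] := ta_bounded f; have [N' gN'] := ta_bounded g.
have fM n : (maxn N N' <= n)%N -> f n = 0 by rewrite geq_max => /andP[/fN].
have gM n : (maxn N N' <= n)%N -> g n = 0 by rewrite geq_max => /andP[_ /gN'].
rewrite (ta_liftE fM) (ta_liftE gM) (@ta_liftE (maxn N N')) => [|n le].
  by rewrite -sumrB; apply: eq_bigr => i _; rewrite -raddfB.
by rewrite /= fM // gM // oppr0 addr0.
Qed.
HB.instance Definition _ :=
  GRing.isZmodMorphism.Build T R ta_lift ta_lift_is_zmod_morphism.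

Lemma ta_lift_in n (x : tpow M n) : ta_lift (ta_in x) = tpow_lift x.
Proof.
rewrite (@ta_liftE n.+1) => [|m nm]; last first.
  by rewrite /= hcomp_neq // ltn_eqF.
rewrite big_ord_recr /= hcomp_id big1 ?add0r // => i _.
by rewrite hcomp_neq ?raddf0 // gtn_eqF.
Qed.

Fact ta_lift_is_monoid_morphism : monoid_morphism ta_lift.
Proof.
split; first by rewrite [LHS]ta_lift_in; apply: rmorph1.
move=> f g; have [N ->] := ta_in_decomp f; have [N' ->] := ta_in_decomp g.
rewrite mulr_suml !raddf_sum mulr_suml; apply: eq_bigr => i _.
rewrite mulr_sumr raddf_sum mulr_sumr; apply: eq_bigr => j _.
rewrite [LHS](congr1 ta_lift (ta_inM (f i) (g j))) ta_lift_in tpow_liftM.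
by rewrite -!ta_lift_in.
Qed.
HB.instance Definition _ :=
  GRing.isMonoidMorphism.Build T R ta_lift ta_lift_is_monoid_morphism.

Lemma tens_alg_universal : exists F : {rmorphism T -> R},
  (forall d : D, F (ta_in (m := 0) (d : tpow M 0)) = g0 d) /\
  (forall a : M, F (ta_in (m := 1) (a : tpow M 1)) = g1 a).
Proof. by exists ta_lift; split=> x; apply: ta_lift_in. Qed.

End Lift.
End TensorAlgebraTheory.

(** * Relations on a species *)

Lemma bim_l_sum (A B : pzRingType) (V : bimod A B) a
    I (t : seq I) P (f : I -> V) :
  bim_l a (\sum_(i <- t | P i) f i) = \sum_(i <- t | P i) bim_l a (f i).
Proof.
apply: (big_morph (bim_l a) (bim_lDr (bimP V) a)).
by apply: (addrI (bim_l a 0)); rewrite -(bim_lDr (bimP V)) !addr0.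
Qed.

Lemma bim_r_sum (A B : pzRingType) (V : bimod A B) b
    I (t : seq I) P (f : I -> V) :
  bim_r (\sum_(i <- t | P i) f i) b = \sum_(i <- t | P i) bim_r (f i) b.
Proof.
apply: (big_morph (fun v => bim_r v b) (fun v w => bim_rDl (bimP V) v w b)).
by apply: (addrI (bim_r 0 b)); rewrite -(bim_rDl (bimP V)) !addr0.
Qed.

Lemma bim_suml_l (A B : pzRingType) (V : bimod A B) (v : V)
    I (t : seq I) P (f : I -> A) :
  bim_l (\sum_(i <- t | P i) f i) v = \sum_(i <- t | P i) bim_l (f i) v.
Proof.
apply: (big_morph (fun a => @bim_l A B V a v)
  (fun a b => bim_lDl (bimP V) a b v)).
by apply: (addrI (@bim_l A B V 0 v)); rewrite -(bim_lDl (bimP V)) !addr0.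
Qed.

Lemma bim_sumr_r (A B : pzRingType) (V : bimod A B) (v : V)
    I (t : seq I) P (f : I -> B) :
  bim_r v (\sum_(i <- t | P i) f i) = \sum_(i <- t | P i) bim_r v (f i).
Proof.
apply: (big_morph (fun a => @bim_r A B V v a)
  (fun a b => bim_rDr (bimP V) v a b)).
by apply: (addrI (@bim_r A B V v 0)); rewrite -(bim_rDr (bimP V)) !addr0.
Qed.

Lemma dsum_sumE (I : finType) (V : I -> zmodType) J (t : seq J) P
    (f : J -> dsum V) i :
  (\sum_(j <- t | P j) f j) i = \sum_(j <- t | P j) f j i.
Proof.
by apply: (big_morph (fun f : dsum V => f i)) => [x y|];
   [apply: dsumDE|rewrite ffunE].
Qed.

Lemma dsum_in_sum (I : finType) (V : I -> zmodType) (x : dsum V) :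
  \sum_i dsum_in (x i) = x.
Proof.
apply/ffunP => i; rewrite dsum_sumE (bigD1 i) //= dsum_in_eq.
by rewrite big1 ?addr0 // => j ji; rewrite dsum_in_neq.
Qed.

Section SpeciesTensorTheory.
Variables (k : fieldType) (S : species k).
Local Notation I := (sp_vertex S).
Local Notation T := (sp_tens S).
Local Notation J := (ta_aug (sp_bimod S)).

Definition in_vertex (i : I) (d : sp_div i) : sp_D S :=
  dsum_in (V := @sp_div k S) d.
Definition in_arrow (j i : I) (m : sp_mod j i) : sp_M S :=
  dsum_in (V := fun p : I * I => @sp_mod k S p.1 p.2) (i := (j, i)) m.

Lemma mul_in_vertex (d : sp_D S) (i : I) (x : sp_div i) :
  d * in_vertex x = in_vertex (d i * x).
Proof.
apply/ffunP => j; rewrite ffunE /in_vertex.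
have [<-|ij] := eqVneq i j; first by rewrite !dsum_in_eq.
by rewrite !dsum_in_neq // mulr0.
Qed.

Lemma mulr_in_vertex (d : sp_D S) (i : I) (x : sp_div i) :
  in_vertex x * d = in_vertex (x * d i).
Proof.
apply/ffunP => j; rewrite ffunE /in_vertex.
have [<-|ij] := eqVneq i j; first by rewrite !dsum_in_eq.
by rewrite !dsum_in_neq // mul0r.
Qed.

Lemma sum_in_vertex : \sum_i in_vertex (1 : sp_div i) = 1.
Proof.
rewrite -[RHS](@dsum_in_sum _ (@sp_div k S)); apply: eq_bigr => i _.
by rewrite ffunE.
Qed.

Lemma sp_0lact (j i : I) (m : sp_mod j i) : sp_lact 0 m = 0.
Proof.
by apply: (addrI (sp_lact 0 m)); rewrite -(bim_lDl (sp_modP j i)) !addr0.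
Qed.
Lemma sp_0ract (j i : I) (m : sp_mod j i) : sp_ract m 0 = 0.
Proof.
by apply: (addrI (sp_ract m 0)); rewrite -(bim_rDr (sp_modP j i)) !addr0.
Qed.

Lemma in_vertex_corner (j i : I) (m : sp_M S) :
  spM_l (in_vertex (1 : sp_div j)) (spM_r m (in_vertex (1 : sp_div i))) =
  in_arrow (m (j, i)).
Proof.
apply/ffunP => -[j' i']; rewrite [LHS]ffunE [spM_r _ _ _]ffunE /= /in_vertex.
have [<-|jj'] := eqVneq j j'; last first.
  rewrite (dsum_in_neq _ jj') sp_0lact /in_arrow dsum_in_neq //.
  by apply: contraNneq jj' => -[->].
rewrite dsum_in_eq (bim_l1 (sp_modP _ _)).
have [<-|ii'] := eqVneq i i'.
  by rewrite dsum_in_eq (bim_r1 (sp_modP _ _)) /in_arrow dsum_in_eq.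
rewrite (dsum_in_neq _ ii') sp_0ract /in_arrow dsum_in_neq //.
by apply: contraNneq ii' => -[->].
Qed.

Definition vertex_idem (i : I) : T :=
  ta_in (M := sp_bimod S) (m := 0) (in_vertex (1 : sp_div i)).
Local Notation ve := vertex_idem.

Lemma sum_vertex_idem : \sum_i ve i = 1.
Proof.
apply: etrans (congr1 (ta_in (M := sp_bimod S) (m := 0)) sum_in_vertex).
symmetry; apply: (big_morph (ta_in (M := sp_bimod S) (m := 0))).
  exact: ta_inD.
exact: ta_in0.
Qed.

Lemma vertex_idem_idem i : ve i * ve i = ve i.
Proof.
rewrite [LHS]ta_inM; congr ta_in; rewrite [LHS]mul_in_vertex.
by rewrite /in_vertex dsum_in_eq mulr1.
Qed.

Lemma arrow_corner (j i : I) (m : sp_M S) :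
  ve j * ta_in (M := sp_bimod S) (m := 1) m * ve i = spT_arrow (m (j, i)).
Proof.
rewrite -mulrA [X in _ * X = _]ta_inM [LHS]ta_inM; congr ta_in.
exact: in_vertex_corner.
Qed.

Lemma spT_arrowN (j i : I) (m : sp_mod j i) : - spT_arrow m = spT_arrow (- m).
Proof.
rewrite -[LHS]sub0r -(ta_in0 (sp_bimod S) 1) /spT_arrow.
apply: etrans (esym (@ta_inB _ (sp_bimod S) 1 _ _)) _; congr ta_in.
apply/ffunP => p; rewrite [LHS]dsumDE [X in X + _]ffunE [X in _ + X]ffunE add0r.
have [<-|jip] := eqVneq (j, i) p; first by rewrite !dsum_in_eq.
by rewrite !dsum_in_neq // oppr0.
Qed.

Lemma spT_arrow0 (j i : I) : spT_arrow (0 : sp_mod j i) = 0.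
Proof.
rewrite -[RHS](@ta_in0 _ (sp_bimod S) 1) /spT_arrow; congr ta_in.
apply/ffunP => p; rewrite [RHS]ffunE.
have [<-|jip] := eqVneq (j, i) p; first by rewrite dsum_in_eq.
by rewrite dsum_in_neq.
Qed.

(** The sign is absorbed by the leftmost arrow. Relations are sums without coefficients, so this is
    what makes differences available. *)
Lemma elem_tensorN (a b : I) (t : T) :
  elem_tensor a b t -> elem_tensor a b (- t).
Proof.
case=> [b' g ab|b' c g t' bc tt].
  by rewrite spT_arrowN; apply: ElemTensor1.
by rewrite -mulNr spT_arrowN; apply: ElemTensorS.
Qed.

Lemma is_relationN (a b : I) (t : T) :
  is_relation a b t -> is_relation a b (- t).
Proof.
move=> [n [g [gE ->]]]; exists n, (fun l => - g l).
by split=> [l|]; [apply: elem_tensorN|rewrite sumrN].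
Qed.

Lemma is_relationD a b (t u : T) :
  is_relation a b t -> is_relation a b u -> is_relation a b (t + u).
Proof.
move=> [n [g [gE ->]]] [m [h [hE ->]]].
pose f (l : 'I_(n.+1 + m.+1)) :=
  match split l with inl i => g i | inr i => h i end.
exists (n + m.+1)%N, f; split=> [l|]; first by rewrite /f; case: split.
rewrite [RHS](@big_split_ord _ _ _ n.+1 m.+1); congr (_ + _).
  by apply: eq_bigr => i _; rewrite /f (unsplitK (inl i)).
by apply: eq_bigr => i _; rewrite /f (unsplitK (inr i)).
Qed.

Lemma is_relation_arrow (a b c : I) (g : sp_mod c b) (t : T) : sp_arrow b c ->
  is_relation a b t -> is_relation a c (spT_arrow g * t).
Proof.
move=> bc [n [h [hE ->]]]; exists n, (fun l => spT_arrow g * h l).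
by split=> [l|]; [apply: ElemTensorS|rewrite mulr_sumr].
Qed.

(** Zero is allowed separately because a relation has at least one summand: without a path from [a]
    to [b] there is no elementary tensor, and zero is not a relation. *)
Definition relation0 a b (t : T) := t = 0 \/ is_relation a b t.

Lemma relation0B a b t u :
  relation0 a b t -> relation0 a b u -> relation0 a b (t - u).
Proof.
move=> [->|ht] [->|hu]; rewrite ?subr0 ?sub0r; first by left.
- by right; apply: is_relationN.
- by right.
- by right; apply: is_relationD => //; apply: is_relationN.
Qed.

Lemma relation0D a b t u :
  relation0 a b t -> relation0 a b u -> relation0 a b (t + u).
Proof.
move=> ht hu; rewrite -[u]opprK -[- u]sub0r.
by do 2?apply: relation0B => //; left.
Qed.

Lemma relation0_corner n (x : tpow (sp_bimod S) n.+1) a b :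
  relation0 a b (ve b * ta_in x * ve a).
Proof.
elim: n x a b => [|n IH] x a b.
  rewrite arrow_corner.
  have [m0|m0] := eqVneq ((x : sp_M S) (b, a)) 0.
    by left; rewrite m0 spT_arrow0.
  right; exists 0%N, (fun=> spT_arrow ((x : sp_M S) (b, a))).
  rewrite big_ord1; split=> // _; apply: ElemTensor1.
  by exists ((x : sp_M S) (b, a)).
move: x; apply: tcons_ind => [|x y hx hy|m y].
- by left; rewrite ta_in0 mulr0 mul0r.
- by rewrite ta_inB mulrBr mulrBl; apply: relation0B.
rewrite ta_in_tconsE.
(* Insert [1] as the sum of the [ve c] after the first tensor factor. Idempotence lets each [ve c]
   close the corner of [m] and open that of [y]. *)
have -> : ve b * (ta_in (m := 1) (m : tpow (sp_bimod S) 1) * ta_in y) * ve a =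
    \sum_c spT_arrow ((m : sp_M S) (b, c)) * (ve c * ta_in y * ve a).
  rewrite -[X in X * ta_in y]mulr1 -sum_vertex_idem !(mulr_sumr, mulr_suml).
  apply: eq_bigr => c _; rewrite -arrow_corner -!mulrA.
  by rewrite (mulrA (ve c) (ve c)) vertex_idem_idem.
apply: (big_ind (relation0 a b)) => [|t u|c _]; [by left|exact: relation0D|].
(* A nonzero component witnesses the arrow from [c] to [b] required to prolong a path; a zero
   component removes the term. *)
have [m0|m0] := eqVneq ((m : sp_M S) (b, c)) 0.
  by left; rewrite m0 spT_arrow0 mul0r.
have [->|rel] := IH y a c; first by left; rewrite mulr0.
by right; apply: is_relation_arrow => //; exists ((m : sp_M S) (b, c)).
Qed.

End SpeciesTensorTheory.

(** * The presentation *)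

Section Presentation.
Variables (k : fieldType) (L : falgType k) (S : species k).
Local Notation r := (jacobson_rad L).
Local Notation I := (sp_vertex S).
Local Notation T := (sp_tens S).
Local Notation J := (ta_aug (sp_bimod S)).
Local Notation cot := (cot_bimod r).
Variables (theta : {rmorphism sp_D S -> rquot r}).
Variables (eta : forall j i, {additive @sp_mod k S j i -> cotangent r}).
Hypothesis theta_bij : bijective theta.
Hypothesis theta_scalar : forall c, theta (spD_scalar S c) = rquot_pi r c%:A.
Hypothesis eta_inj : forall j i, injective (eta j i).
Hypothesis eta_range : forall j i, range (eta j i) =
  zspan [set y | exists d x d', y =
    cot_ract (cot_lact (theta (in_vertex (d : sp_div j))) x)
      (theta (in_vertex (d' : sp_div i)))].
Hypothesis eta_bimod :
  forall (j i : I) (d : sp_div j) (m : sp_mod j i) (d' : sp_div i),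
  eta _ _ (sp_ract (sp_lact d m) d') =
  cot_ract (cot_lact (theta (in_vertex d)) (eta _ _ m)) (theta (in_vertex d')).

(** Writing [m] as [1 m 1] brings in the idempotents at [j] and [i], and multiplying [d] by the
    first keeps only [d j]. Two-sided compatibility thus yields linearity over all of [D]. *)
Let eta_l (d : sp_D S) (j i : I) (m : sp_mod j i) :
  @bim_l _ _ cot (theta d) (eta _ _ m) = eta _ _ (sp_lact (d j) m).
Proof.
rewrite -[m in LHS](bim_l1 (sp_modP j i)).
rewrite -[in LHS](bim_r1 (sp_modP j i) (sp_lact 1 m)).
rewrite [X in bim_l _ X](eta_bimod 1 m 1).
rewrite [LHS](bim_lr (bimP cot)) -[X in bim_r X _ = _](bim_lM (bimP cot)).
rewrite -rmorphM mul_in_vertex mulr1.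
by rewrite -[LHS](eta_bimod (d j) m 1) (bim_r1 (sp_modP j i)).
Qed.

Let eta_r (d : sp_D S) (j i : I) (m : sp_mod j i) :
  @bim_r _ _ cot (eta _ _ m) (theta d) = eta _ _ (sp_ract m (d i)).
Proof.
rewrite -[m in LHS](bim_l1 (sp_modP j i)).
rewrite -[in LHS](bim_r1 (sp_modP j i) (sp_lact 1 m)).
rewrite [X in bim_r X _](eta_bimod 1 m 1).
rewrite -[LHS](bim_rM (bimP cot)) -rmorphM mulr_in_vertex mul1r.
by rewrite -[LHS](eta_bimod 1 m (d i)) (bim_l1 (sp_modP j i)).
Qed.

Definition eta_sum (m : sp_M S) : cotangent r := \sum_p eta _ _ (m p).

Fact eta_sum_is_zmod_morphism : zmod_morphism eta_sum.
Proof.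
move=> m m'; rewrite /eta_sum -sumrB; apply: eq_bigr => p _.
by rewrite dsumDE [(- m') p]ffunE raddfB.
Qed.
HB.instance Definition _ :=
  GRing.isZmodMorphism.Build (sp_M S) (cotangent r) eta_sum
    eta_sum_is_zmod_morphism.

Let eta_sum_l d m : eta_sum (spM_l d m) = @bim_l _ _ cot (theta d) (eta_sum m).
Proof.
rewrite [in RHS]/eta_sum bim_l_sum; apply: eq_bigr => p _.
by rewrite eta_l ffunE.
Qed.

Let eta_sum_r d m : eta_sum (spM_r m d) = @bim_r _ _ cot (eta_sum m) (theta d).
Proof.
rewrite [in RHS]/eta_sum bim_r_sum; apply: eq_bigr => p _.
by rewrite eta_r ffunE.
Qed.

Let eta_sum_in (j i : I) (m : sp_mod j i) : eta_sum (in_arrow m) = eta _ _ m.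
Proof.
exact: (@big_dsum_in _ _ _ (fun p (x : sp_mod p.1 p.2) => eta _ _ x) (j, i) m
  (fun p => raddf0 _)).
Qed.

(** Cutting by the idempotents at [j] and [i] isolates one component of [m], where [eta j i] is
    injective. *)
Lemma eta_sum_inj m : eta_sum m = 0 -> m = 0.
Proof.
move=> m0; apply/ffunP => -[j i]; rewrite [RHS]ffunE; apply: eta_inj.
rewrite raddf0 -eta_sum_in -in_vertex_corner eta_sum_l eta_sum_r m0.
have cot0 a : @bim_l _ _ cot a 0 = 0.
  by apply: (addrI (@bim_l _ _ cot a 0)); rewrite -(bim_lDr (bimP cot)) !addr0.
have cot0' a : @bim_r _ _ cot 0 a = 0.
  by apply: (addrI (@bim_r _ _ cot 0 a)); rewrite -(bim_rDl (bimP cot)) !addr0.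
by rewrite cot0' cot0.
Qed.

(** Inserting the decomposition of [1] on both sides splits [x] into corners, each in the range of
    some [eta j i]. *)
Lemma eta_sum_surj x : exists m, eta_sum m = x.
Proof.
have sum1 : \sum_i theta (in_vertex (1 : sp_div (s := S) i)) = 1.
  by rewrite -[RHS](rmorph1 theta) -sum_in_vertex raddf_sum.
pose y (j i : I) := cot_ract (cot_lact (theta (in_vertex (1 : sp_div j))) x)
  (theta (in_vertex (1 : sp_div i))).
have yE j i : exists m : sp_mod (s := S) j i, eta _ _ m = y j i.
  suff : range (eta j i) (y j i) by move=> [m _ <-]; exists m.
  by rewrite eta_range; apply: sub_zspan; exists 1, x, 1.
exists [ffun p => sval (cid (yE p.1 p.2))].
have -> : x = \sum_j \sum_i y j i.
  rewrite exchange_big -[LHS](bim_r1 (bimP cot)) -sum1 bim_sumr_r.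
  apply: eq_bigr => i _; rewrite -[x in LHS](bim_l1 (bimP cot)) -sum1.
  by rewrite bim_suml_l bim_r_sum.
rewrite pair_bigA; apply: eq_bigr => p _; rewrite ffunE.
by case: (cid _).
Qed.

Variable eps : {rmorphism rquot r -> L}.
Variable s : {additive cotangent r -> ideal_sub r}.
Hypothesis eps_split : split_section eps.
Hypothesis sK : forall x, cot_pi (s x) = x.
Hypothesis s_l : forall d x, s (cot_lactR (eps d) x) = ideal_lact (eps d) (s x).
Hypothesis s_r : forall x d, s (cot_ractR x (eps d)) = ideal_ract (s x) (eps d).

Let epsK x : rquot_pi r (eps x) = x. Proof. by have [_ ->] := eps_split. Qed.

Definition arrow_lift (m : sp_bimod S) : L := ideal_val (s (eta_sum m)).

Fact arrow_lift_is_zmod_morphism : zmod_morphism arrow_lift.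
Proof. by move=> m m'; rewrite /arrow_lift !raddfB. Qed.
HB.instance Definition _ :=
  GRing.isZmodMorphism.Build (sp_bimod S) L arrow_lift
    arrow_lift_is_zmod_morphism.

Lemma arrow_lift_l d m :
  arrow_lift (bim_l d m) = (eps \o theta) d * arrow_lift m.
Proof.
rewrite /arrow_lift [eta_sum _]eta_sum_l -(epsK (theta d)).
by rewrite [bim_l _ _]cot_lactE s_l.
Qed.

Lemma arrow_lift_r m d :
  arrow_lift (bim_r m d) = arrow_lift m * (eps \o theta) d.
Proof.
rewrite /arrow_lift [eta_sum _]eta_sum_r -(epsK (theta d)).
by rewrite [bim_r _ _]cot_ractE s_r.
Qed.

Lemma presentation_morphism : exists F : {rmorphism T -> L},
  (forall d : sp_D S, F (ta_in (M := sp_bimod S) (m := 0) d) = eps (theta d)) /\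
  (forall m : sp_M S, F (ta_in (M := sp_bimod S) (m := 1) m) =
     ideal_val (s (eta_sum m))).
Proof. exact: (tens_alg_universal arrow_lift_l arrow_lift_r). Qed.

Variable F : {rmorphism T -> L}.
Hypothesis F_vertex :
  forall d : sp_D S, F (ta_in (M := sp_bimod S) (m := 0) d) = eps (theta d).
Hypothesis F_arrow : forall m : sp_M S,
  F (ta_in (M := sp_bimod S) (m := 1) m) = ideal_val (s (eta_sum m)).

Lemma presentation_aug f : J f -> r (F f).
Proof.
move=> f0; have [N ->] := ta_in_decomp f; rewrite raddf_sum.
apply: (big_ind (fun x => r x)); first exact: (@ideal0 _ r).
  by move=> x y; apply: (@idealD _ r).
move=> [[|n] nN] _ /=; first by rewrite f0 ta_in0 raddf0; apply: (@ideal0 _ r).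
move: (f n.+1); apply: tcons_ind => [|x y rx ry|m y].
- by rewrite ta_in0 raddf0; apply: (@ideal0 _ r).
- by rewrite ta_inB raddfB; apply: (@idealB _ r).
- rewrite ta_in_tconsE rmorphM F_arrow; apply: (@Defs.idealMr _ r).
  exact: ideal_valP.
Qed.

Lemma presentation_aug_exp n f : ideal_exp J n f -> ideal_exp r n (F f).
Proof.
elim: n f => [//|n IH] f.
apply: (@ideal_expS_ind _ J n (fun f => ideal_exp r n.+1 (F f))).
- by rewrite raddf0; apply: (@ideal0 _ (ideal_exp r n.+1)).
- by move=> x y hx hy; rewrite raddfB; apply: (@idealB _ (ideal_exp r n.+1)).
- move=> x y Jx Jy; rewrite rmorphM.
  by apply: ideal_expS; [apply: presentation_aug|apply: IH].
Qed.

Lemma presentation_ker_aug2 f : F f = 0 -> ideal_exp J 2 f.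
Proof.
move=> Ff.
(* [h] is the part of [f] in degrees at least two, so [F h] lies in [r^2]; and [F f = 0] expresses
   [F h] through the two lowest components. *)
pose h : T :=
  f - ta_in (M := sp_bimod S) (f 0%N) - ta_in (M := sp_bimod S) (f 1%N).
have h2 : ideal_exp J 2 h.
  by apply: ta_aug_exp2; rewrite /= hcomp_id [hcomp _ _]hcomp_neq //
    ?subr0 ?subrr ?oppr0 ?add0r.
have Fh : F h = - eps (theta (f 0%N)) - ideal_val (s (eta_sum (f 1%N))).
  by rewrite /h !rmorphB /= Ff sub0r F_vertex F_arrow.
have rFh : ideal_exp r 2 (F h) by apply: presentation_aug_exp.
(* Modulo [r] both [F h] and the arrow term disappear, leaving [theta (f 0)]. *)
have f0 : f 0%N = 0.
  apply: (bij_inj theta_bij); rewrite raddf0 -[LHS]epsK.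
  rewrite -[RHS](raddf0 (rquot_pi r)).
  apply/rquot_piP; rewrite subr0.
  have -> : eps (theta (f 0%N)) = - F h - ideal_val (s (eta_sum (f 1%N))).
    by rewrite Fh opprB opprK addrAC subrr add0r.
  apply: idealB; last exact: ideal_valP.
  by apply: idealN; apply/ideal_exp1; apply: (@ideal_expSW _ r 1 _ rFh).
(* With degree zero gone, the lift of [eta_sum (f 1)] equals [- F h], so its class modulo [r^2] is
   zero. *)
have f1 : f 1%N = 0.
  apply: eta_sum_inj; rewrite -[LHS]sK -[RHS](raddf0 (@cot_pi _ r)).
  apply/cot_piP; rewrite [X in _ - X](_ : _ = 0) ?subr0 //.
  have -> : ideal_val (s (eta_sum (f 1%N))) = - F h.
    by rewrite Fh f0 !raddf0 sub0r opprK.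
  exact: idealN.
exact: ta_aug_exp2.
Qed.

(* The image of F meets every coset of r^(n+1) contained in r^n, so it is
   everything because r is nilpotent. *)
Lemma presentation_surj x : exists f, F f = x.
Proof.
pose B := [set x | exists f, F f = x].
have B0 : B 0 by exists 0; rewrite raddf0.
have BB u v : B u -> B v -> B (u - v).
  by move=> [f <-] [g <-]; exists (f - g); rewrite raddfB.
have BM u v : B u -> B v -> B (u * v).
  by move=> [f <-] [g <-]; exists (f * g); rewrite rmorphM.
have B_r y : r y -> exists2 b, B b & ideal_exp r 2 (y - b).
  move=> ry; pose y' := IdealSub (introT (asboolP _) ry).
  have [m mE] := eta_sum_surj (cot_pi y').
  exists (ideal_val (s (eta_sum m))).
    by exists (ta_in (M := sp_bimod S) (m := 1) m).
  by apply/(cot_piP y' _); rewrite sK mE.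
have step n : ideal_exp r n `<=`
    [set y | exists2 b, B b & ideal_exp r n.+1 (y - b)].
  elim: n => [y _|n IH].
    have [d dE] : exists d, theta d = rquot_pi r y.
      by have [g _ gK] := theta_bij; exists (g (rquot_pi r y)).
    exists (eps (theta d)).
      by exists (ta_in (M := sp_bimod S) (m := 0) d).
    by apply/ideal_exp1/rquot_piP; rewrite epsK dE.
  apply: ideal_expS_ind => [|y z [b Bb hb] [c Bc hc]|y z ry rz].
  - by exists 0 => //; rewrite subrr; apply: ideal0.
  - exists (b - c); first exact: BB.
    have -> : y - z - (b - c) = (y - b) - (z - c).
      by rewrite !opprB [c - b]addrC addrACA [- z + c]addrC.
    exact: idealB.
  (* The error of [b * c] is [(y - b) * z + b * (z - c)]. Approximating [y] modulo [r^2] puts the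
     first term deep enough; the second works because [b] still lies in [r]. *)
  - have [b Bb hb] := B_r y ry; have [c Bc hc] := IH z rz.
    exists (b * c); first exact: BM.
    have -> : y * z - b * c = (y - b) * z + b * (z - c).
      by rewrite mulrBl mulrBr addrA subrK.
    apply: idealD; first by have := ideal_expD hb rz; rewrite add2n.
    apply: ideal_expS => //.
    have -> : b = y - (y - b) by rewrite opprB addrC subrK.
    by apply: idealB => //; apply/ideal_exp1; apply: (@ideal_expSW _ r 1 _ hb).
(* Descent, one power at a time, starting from the zero power [r^rl]. *)
have all n m : ideal_exp r (n + m) `<=` B -> ideal_exp r m `<=` B.
  elim: n => [//|n IH] h; apply: IH => y /step[b Bb hb].
  have -> : y = y - b - (0 - b) by rewrite sub0r opprK subrK.
  by apply: (BB); [apply: h|apply: (BB)].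
have : B x; last by [].
apply: (all (rad_length L) 0%N) => //; rewrite addn0 ideal_exp_rad_length.
by move=> _ ->.
Qed.

Lemma presentation : exists rho : set T,
  [/\ relation_set rho,
      ideal_exp J (rad_length L) `<=` ideal_gen rho,
      ideal_gen rho `<=` ideal_exp J 2 &
      exists f : {rmorphism L -> rquot (ideal_gen rho)},
        bijective f /\
        forall c : k, f c%:A = rquot_pi (ideal_gen rho) (spT_scalar S c)].
Proof.
pose rho : set T := [set z | F z = 0 /\ exists a b, is_relation a b z].
have kerP : is_ideal [set z | F z = 0].
  do ![split] => /=.
  - exact: raddf0.
  - by move=> x y x0 y0; rewrite rmorphB x0 y0 subrr.
  - by move=> a x x0; rewrite rmorphM x0 mulr0.
  - by move=> x a x0; rewrite rmorphM x0 mul0r.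
have gen_ker z : ideal_gen rho z -> F z = 0.
  by move=> /(_ [set z | F z = 0]); apply; split=> // y [].
have ker_gen z : F z = 0 -> ideal_gen rho z.
  move=> Fz.
  (* Relations have no component in degree zero, so [z] must first be known to lie in [J]. *)
  have z0 : z 0%N = 0.
    by have /ideal_exp1 : ideal_exp J 1 z :=
      @ideal_expSW _ J 1 _ (presentation_ker_aug2 Fz).
  (* Each corner of [z] is still in the kernel and has a definite start and end, so it is zero or a
     member of [rho]. *)
  have -> : z = \sum_b \sum_a vertex_idem b * z * vertex_idem a.
    rewrite -[LHS]mulr1 -[LHS]mul1r -!sum_vertex_idem mulr_suml.
    by apply: eq_bigr => b _; rewrite !mulr_sumr; apply: eq_bigr => a _; rewrite mulrA.
  have sum_gen (A : finType) (h : A -> T) :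
      (forall a, ideal_gen rho (h a)) -> ideal_gen rho (\sum_a h a).
    move=> hA; apply: (big_ind (fun x => ideal_gen rho x)) => //; first exact: ideal0.
    by move=> x y; apply: idealD.
  apply: (sum_gen) => b; apply: (sum_gen) => a.
  have [->|rel] : relation0 a b (vertex_idem b * z * vertex_idem a).
  - have [N ->] := ta_in_decomp z; rewrite mulr_sumr mulr_suml.
    apply: (big_ind (relation0 a b)) => [|t u|[[|n] nN] _]; first by left.
    + exact: relation0D.
    + by rewrite /= z0 ta_in0 mulr0 mul0r; left.
    + exact: relation0_corner.
  - exact: ideal0.
  - move=> K [_]; apply; split; last by exists a, b.
    by rewrite !rmorphM Fz mulr0 mul0r.
exists rho; split.
- by move=> z [].
- move=> z /presentation_aug_exp rFz; apply: ker_gen.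
  by have : [set 0] (F z) by rewrite -(ideal_exp_rad_length L).
- by move=> z /gen_ker; apply: presentation_ker_aug2.
(* The isomorphism is built from an arbitrary set-theoretic section [h] of [F]. Two preimages differ
   by a kernel element, so additivity and multiplicativity hold in the quotient. *)
have [h hK] := choice presentation_surj.
pose pi := rquot_pi (ideal_gen rho).
have piE z z' : F z = F z' -> pi z = pi z'.
  by move=> E; apply/rquot_piP; apply: ker_gen; rewrite rmorphB E subrr.
pose f x := pi (h x).
have fB : zmod_morphism f.
  by move=> x y; rewrite /f -rmorphB; apply: piE; rewrite rmorphB !hK.
have fM : monoid_morphism f.
  split=> [|x y]; first by rewrite -[RHS](rmorph1 pi); apply: piE; rewrite hK rmorph1.
  by rewrite /f -rmorphM; apply: piE; rewrite rmorphM !hK.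
pose f' : {rmorphism L -> rquot (ideal_gen rho)} :=
  HB.pack f (GRing.isZmodMorphism.Build _ _ f fB)
            (GRing.isMonoidMorphism.Build _ _ f fM).
exists f'; split.
  exists (fun q => F (rquot_repr q)) => [x|q].
    rewrite /= /f -[RHS]hK; apply/eqP; rewrite -subr_eq0 -rmorphB; apply/eqP.
    by apply: gen_ker; apply/rquot_piP; rewrite rquot_reprK.
  by rewrite -[RHS]rquot_reprK; apply: piE; rewrite hK.
move=> c; apply: piE; rewrite hK [RHS]F_vertex theta_scalar.
by have [-> _] := eps_split.
Qed.

End Presentation.

Theorem proposition3p3 (k : fieldType) (L : falgType k)
    (hbasic : basic_algebra L) (hrsplit : rsplit_algebra L) :
  (exists S : species k, species_of L S) /\
  forall S : species k, species_of L S ->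
    exists rho : set (sp_tens S),
      [/\ relation_set rho,
          ideal_exp (ta_aug (sp_bimod S)) (rad_length L) `<=` ideal_gen rho,
          ideal_gen rho `<=` ideal_exp (ta_aug (sp_bimod S)) 2 &
          exists f : {rmorphism L -> rquot (ideal_gen rho)},
            bijective f /\
            forall c : k, f c%:A = rquot_pi (ideal_gen rho) (spT_scalar S c)].
Proof.
split; first exact: species_of_exists.
move=> S [theta [eta /= [theta_bij theta_scalar etaP]]].
have [[eps eps_split] /(_ eps eps_split)[s [sK s_l s_r]]] := hrsplit.
have eta_inj j i : injective (eta j i) by have [] := etaP j i.
have eta_range j i := let: And3 _ e _ := etaP j i in e.
have eta_bimod j i := let: And3 _ _ e := etaP j i in e.
have [F [F_vertex F_arrow]] :=
  presentation_morphism eta_bimod eps_split s_l s_r.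
exact: (presentation theta_bij theta_scalar eta_inj eta_range eta_bimod
  eps_split sK F_vertex F_arrow).
Qed.
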